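(* Let $\tau\in\mathbb{C}$ with $\operatorname{Im}\tau>0$, let $\Sigma=\mathbb{C}/(\mathbb{Z}+\mathbb{Z}\tau)$, and let $E$ be the rank $2$ holomorphic vector bundle over $\Sigma$ whose total space is $X=(\mathbb{C}\times\mathbb{C}^2)/\mathbb{Z}^2$, where the two generators of $\mathbb{Z}^2$ act by $(z,z_1,z_2)\mapsto(z+1,z_1,z_2)$ and $(z,z_1,z_2)\mapsto(z+\tau,z_1+z_2,z_2)$. Then for every holomorphic function $f\in\mathcal{O}(X)$ there is an entire function $F\in\mathcal{O}(\mathbb{C})$ such that the lift of $f$ to $\mathbb{C}^3$ is $(z,z_1,z_2)\mapsto F(z_2)$.
   Context: $\mathcal{O}(X)$ denotes the ring of holomorphic functions on a complex manifold $X$. The lift of $f\in\mathcal{O}(X)$ to $\mathbb{C}^3$ is the composition of $f$ with the quotient map $\mathbb{C}^3\to X$. *)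

(* Defs.v *)
From Stdlib Require Import Reals ZArith Lra Lia Psatz.
From Stdlib Require Import FunctionalExtensionality PropExtensionality ProofIrrelevance.
From Coquelicot Require Import Coquelicot.

Open Scope R_scope.

(* Complex differentiability (over [C_AbsRing]) at every point of [D]; it is
   holomorphy when [D] is open. *)
Definition holomorphic_on {V : NormedModule C_AbsRing}
    (D : V -> Prop) (f : V -> C) : Prop :=
  forall p : V, D p -> ex_filterdiff (V := C_NormedModule) f (locally p).

Definition entire (F : C -> C) : Prop :=
  forall w : C, ex_derive (K := C_AbsRing) (V := C_NormedModule) F w.

(* C x C^2, whose points are written (z, (z1, z2)). *)
Definition C3 : NormedModule C_AbsRing :=
  prod_NormedModule C_AbsRing C_NormedModule
    (prod_NormedModule C_AbsRing C_NormedModule C_NormedModule).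

Definition gen1 (p : C3) : C3 :=
  let '(z, (z1, z2)) := p in (Cplus z 1, (z1, z2)).

Definition gen2 (tau : C) (p : C3) : C3 :=
  let '(z, (z1, z2)) := p in (Cplus z tau, (Cplus z1 z2, z2)).

(* The action of (m, n) in Z^2, i.e. gen1^m gen2^n; it is determined by the
   lemmas [act_0], [act_add], [act_gen1] and [act_gen2]. *)
Definition act (tau : C) (m n : Z) (p : C3) : C3 :=
  let '(z, (z1, z2)) := p in
  (Cplus z (Cplus (IZR m) (Cmult (IZR n) tau)),
   (Cplus z1 (Cmult (IZR n) z2), z2)).

Ltac C_ring :=
  try reflexivity;
  match goal with |- ?a = ?b => change (@eq C a b); ring end.

Lemma act_0 (tau : C) (p : C3) : act tau 0 0 p = p.
Proof.
  destruct p as [z [z1 z2]]; unfold act.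
  apply f_equal2; [|apply f_equal2]; C_ring.
Qed.

Lemma act_add (tau : C) (m n m' n' : Z) (p : C3) :
  act tau (m + m') (n + n') p = act tau m n (act tau m' n' p).
Proof.
  destruct p as [z [z1 z2]]; unfold act.
  rewrite !plus_IZR, !RtoC_plus.
  apply f_equal2; [|apply f_equal2]; C_ring.
Qed.

Lemma act_gen1 (tau : C) (p : C3) : act tau 1 0 p = gen1 p.
Proof.
  destruct p as [z [z1 z2]]; unfold act, gen1.
  apply f_equal2; [|apply f_equal2]; C_ring.
Qed.

Lemma act_gen2 (tau : C) (p : C3) : act tau 0 1 p = gen2 tau p.
Proof.
  destruct p as [z [z1 z2]]; unfold act, gen2.
  apply f_equal2; [|apply f_equal2]; C_ring.
Qed.

Definition orbit (tau : C) (p : C3) : C3 -> Prop :=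
  fun q => exists m n : Z, q = act tau m n p.

(* The quotient (C x C^2) / Z^2, as the set of orbits. *)
Definition X (tau : C) : Type :=
  {S : C3 -> Prop | exists p : C3, S = orbit tau p}.

Definition quot (tau : C) (p : C3) : X tau :=
  exist _ (orbit tau p) (ex_intro _ p eq_refl).

Lemma quot_surj (tau : C) (x : X tau) : exists p : C3, quot tau p = x.
Proof.
  destruct x as [S [p HS]]; exists p; subst S; reflexivity.
Qed.

Lemma quot_eq (tau : C) (p q : C3) :
  quot tau p = quot tau q <-> exists m n : Z, q = act tau m n p.
Proof.
  split.
  - intros H; apply (f_equal (@proj1_sig _ _)) in H; simpl in H.
    change (orbit tau p q); rewrite H.
    exists 0%Z, 0%Z; now rewrite act_0.
  - intros [m [n ->]].
    assert (H : orbit tau p = orbit tau (act tau m n p)).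
    { apply functional_extensionality; intro r.
      apply propositional_extensionality; split; intros [m' [n' ->]].
      - exists (m' - m)%Z, (n' - n)%Z; rewrite <- act_add.
        f_equal; lia.
      - exists (m' + m)%Z, (n' + n)%Z; now rewrite act_add. }
    unfold quot; apply eq_sig_hprop; [intros; apply proof_irrelevance | exact H].
Qed.

(* The complex structure of X is given by the charts (quot|U)^-1, where U runs
   over the open subsets of C3 on which quot is injective. *)
Definition chart_domain (tau : C) (U : C3 -> Prop) : Prop :=
  open U /\
  forall p q : C3, U p -> U q -> quot tau p = quot tau q -> p = q.

Definition holomorphic (tau : C) (f : X tau -> C) : Prop :=
  forall U : C3 -> Prop, chart_domain tau U ->
    holomorphic_on U (fun p => f (quot tau p)).

(* These charts cover X. *)
Lemma chart_domain_cover (tau : C) (Htau : 0 < Im tau) (p : C3) :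
  exists U : C3 -> Prop, chart_domain tau U /\ U p.
Proof.
  set (e := Rmin (Im tau) 1 / 2).
  assert (He : 0 < e /\ 2 * e <= Im tau /\ 2 * e <= 1).
  { unfold e; pose proof (Rmin_l (Im tau) 1); pose proof (Rmin_r (Im tau) 1).
    assert (0 < Rmin (Im tau) 1) by (apply Rmin_glb_lt; lra). lra. }
  destruct He as [He [He1 He2]]; clearbody e.
  exists (fun q : C3 => Rabs (Re (fst q) - Re (fst p)) < e /\
                   Rabs (Im (fst q) - Im (fst p)) < e).
  split; [split|].
  - intros q [Hr Hi].
    set (d := Rmin (e - Rabs (Re (fst q) - Re (fst p)))
                   (e - Rabs (Im (fst q) - Im (fst p)))).
    assert (Hd : 0 < d) by (apply Rmin_glb_lt; lra).
    exists (mkposreal d Hd); intros r Hr'.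
    pose proof (Rmin_l (e - Rabs (Re (fst q) - Re (fst p)))
                       (e - Rabs (Im (fst q) - Im (fst p)))) as Hl.
    pose proof (Rmin_r (e - Rabs (Re (fst q) - Re (fst p)))
                       (e - Rabs (Im (fst q) - Im (fst p)))) as Hm.
    fold d in Hl, Hm.
    destruct Hr' as [[Hx Hy] _].
    change (Rabs (Re (fst r) - Re (fst q)) < d) in Hx.
    change (Rabs (Im (fst r) - Im (fst q)) < d) in Hy.
    split; revert Hx Hy Hl Hm Hr Hi; unfold Rabs;
      repeat destruct Rcase_abs; lra.
  - intros q r [Hq1 Hq2] [Hr1 Hr2] Hqr.
    apply quot_eq in Hqr; destruct Hqr as [m [n ->]].
    destruct q as [[x y] [z1 z2]], p as [[a b] p'], tau as [s t].
    simpl in *.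
    apply Rabs_def2 in Hq1, Hq2, Hr1, Hr2.
    assert (Hn : n = 0%Z).
    { destruct (Z.lt_trichotomy n 0) as [H|[H|H]]; [|exact H|].
      - assert (IZR n <= -1) by (apply IZR_le; lia). nra.
      - assert (1 <= IZR n) by (apply IZR_le; lia). nra. }
    subst n.
    assert (Hm : m = 0%Z).
    { destruct (Z.lt_trichotomy m 0) as [H|[H|H]]; [|exact H|].
      - assert (IZR m <= -1) by (apply IZR_le; lia). nra.
      - assert (1 <= IZR m) by (apply IZR_le; lia). nra. }
    subst m.
    symmetry; exact (act_0 (s, t) ((x, y), (z1, z2))).
  - rewrite !Rminus_diag, Rabs_R0; split; exact He.
Qed.

(* Main.v *)
Require Import Defs.
From Stdlib Require Import Reals Lra Lia Psatz ZArith List Classical ClassicalEpsilon.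
From Coquelicot Require Import Coquelicot.

(* Let g be the lift of f, an entire function on C^3 invariant under the action of Z^2,
   and let P_d(z, z1, z2) be its part that is homogeneous of degree d in (z1, z2).  The
   action is linear in (z1, z2), so P_d is invariant too.  Reducing z to a fundamental
   domain changes z1 by n z2 with n = O(1 + |z|), so for fixed z2 = c homogeneity gives
   |P_d(z, z1, c)| = O((1 + |z| + |z1|)^d).  An entire function of polynomial growth with a
   nonzero period is constant: P_d(z, z1, c) has period 1 in z, and then, for c <> 0,
   period c in z1.  Hence P_d(z, z1, c) = P_d(0, 0, c) for all d, so the entire function
   s |-> g(z, s z1, s c) - g(0, 0, s c) has vanishing Taylor coefficients at 0, and
   g(z, z1, z2) = g(0, 0, z2), first for z2 <> 0 and then everywhere by continuity. *)

Open Scope C_scope.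

(** * Complex-valued functions and their integrals *)

(** Holomorphy is given only as complex differentiability at every point, so no continuity of
    derivatives may be assumed. The one-variable theory therefore starts from Goursat's lemma, which
    yields primitives whose derivative is attained uniformly on bounded sets; Cauchy's formula is
    proved for such primitives and reaches every entire function through them. Power series never
    occur: the expansion of the Cauchy kernel is used one term at a time with its remainder, and
    Taylor coefficients are averages over circles. Several variables enter only through the joint
    continuity of g and its restrictions to complex lines.

    Passing to the parts P_d is forced because g itself has no growth bound: over a fundamental
    domain it is bounded only for bounded (z1, z2), while reducing z pushes z1 arbitrarily far.
    Homogeneity permits scaling back to a fixed polydisc at the price of a d-th power, and the price
    stays polynomial in z because the action on the fibre is unipotent, so that its n-th power grows
    only linearly in n. *)

Lemma Ci_neq_0 : Ci <> 0.
Proof. intros E; apply (f_equal snd) in E; cbn in E; lra. Qed.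

Lemma RtoC_neq_0 (x : R) : x <> 0%R -> RtoC x <> 0.
Proof. intros H E; now apply H, RtoC_inj. Qed.

Lemma Cmod_RtoC_nonneg (x : R) : (0 <= x)%R -> Cmod (RtoC x) = x.
Proof. intros H; rewrite Cmod_R; now apply Rabs_pos_eq. Qed.

Lemma Cmod_le_sum (z : C) : (Cmod z <= Rabs (Re z) + Rabs (Im z))%R.
Proof.
  destruct z as [x y]; cbn.
  replace (x, y) with (RtoC x + Ci * RtoC y)
    by (unfold Ci; apply injective_projections; cbn; ring).
  eapply Rle_trans; [apply Cmod_triangle|].
  rewrite Cmod_mult, Cmod_Ci, !Cmod_R; lra.
Qed.

Lemma Im_le_Cmod (z : C) : (Rabs (Im z) <= Cmod z)%R.
Proof. eapply Rle_trans; [|apply Rmax_Cmod]; apply Rmax_r. Qed.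

Lemma Cmod_triangle_inv (a b : C) : (Cmod a - Cmod b <= Cmod (a - b))%R.
Proof.
  assert (H := Cmod_triangle (a - b) b).
  replace (a - b + b) with a in H by ring. lra.
Qed.

(** Balls of [C], as a product of two real lines, are squares; the modulus lies between the larger
    coordinate and the sum of both, so disks and squares give the same neighbourhoods. *)
Lemma continuous_Cmod_iff {T : UniformSpace} (f : T -> C) (x : T) :
  continuous f x <->
  forall eps, (0 < eps)%R -> locally x (fun y => (Cmod (f y - f x) < eps)%R).
Proof.
  split.
  - intros H eps He.
    assert (He' : (0 < eps / 2)%R) by lra.
    apply filterlim_locally with (eps := mkposreal _ He') in H.
    revert H; apply filter_imp; intros y [H1 H2].
    change (Rabs (Re (f y) - Re (f x)) < eps / 2)%R in H1.
    change (Rabs (Im (f y) - Im (f x)) < eps / 2)%R in H2.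
    eapply Rle_lt_trans; [apply Cmod_le_sum|].
    change (Rabs (Re (f y) - Re (f x)) + Rabs (Im (f y) - Im (f x)) < eps)%R.
    lra.
  - intros H; apply filterlim_locally; intros eps.
    generalize (H eps (cond_pos eps)); apply filter_imp; intros y Hy.
    split.
    + eapply Rle_lt_trans; [|exact Hy].
      exact (re_le_Cmod (f y - f x)).
    + eapply Rle_lt_trans; [|exact Hy].
      exact (Im_le_Cmod (f y - f x)).
Qed.

Lemma continuous_C_iff {T : UniformSpace} (f : T -> C) (x : T) :
  continuous f x <->
  continuous (fun y => Re (f y)) x /\ continuous (fun y => Im (f y)) x.
Proof.
  split.
  - intros H; split; apply filterlim_locally; intros eps;
    apply filterlim_locally with (eps := eps) in H;
    revert H; apply filter_imp; intros y [H1 H2]; assumption.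
  - intros [H1 H2]; apply filterlim_locally; intros eps.
    apply filterlim_locally with (eps := eps) in H1.
    apply filterlim_locally with (eps := eps) in H2.
    generalize (filter_and _ _ H1 H2).
    apply filter_imp; intros y [H3 H4]; split; assumption.
Qed.

Definition Ccont {T : UniformSpace} (f : T -> C) : Prop :=
  forall x, continuous f x.

Section Continuity.
Context {T : UniformSpace}.
Implicit Types f g : T -> C.

Lemma Ccont_ext f g : (forall x, f x = g x) -> Ccont f -> Ccont g.
Proof. intros E H x; apply (continuous_ext f); auto. Qed.

Lemma Ccont_const (c : C) : Ccont (fun _ : T => c).
Proof. intros x; apply continuous_const. Qed.

Lemma Ccont_plus f g : Ccont f -> Ccont g -> Ccont (fun x => f x + g x).
Proof.
  intros Hf Hg x; specialize (Hf x); specialize (Hg x).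
  apply continuous_C_iff in Hf; apply continuous_C_iff in Hg.
  apply continuous_C_iff; destruct Hf, Hg; split;
    now apply (continuous_plus (V := R_NormedModule)).
Qed.

Lemma Ccont_opp f : Ccont f -> Ccont (fun x => - f x).
Proof.
  intros Hf x; specialize (Hf x).
  apply continuous_C_iff in Hf; apply continuous_C_iff; destruct Hf; split;
    now apply (continuous_opp (V := R_NormedModule)).
Qed.

Lemma Ccont_minus f g : Ccont f -> Ccont g -> Ccont (fun x => f x - g x).
Proof. intros; apply Ccont_plus; [|apply Ccont_opp]; assumption. Qed.

Lemma Ccont_mult f g : Ccont f -> Ccont g -> Ccont (fun x => f x * g x).
Proof.
  intros Hf Hg x; specialize (Hf x); specialize (Hg x).
  apply continuous_C_iff in Hf; apply continuous_C_iff in Hg.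
  apply continuous_C_iff; destruct Hf, Hg; split; cbn;
  [apply (continuous_minus (V := R_NormedModule))
  |apply (continuous_plus (V := R_NormedModule))];
  now apply (continuous_mult (K := R_AbsRing)).
Qed.

Lemma Ccont_inv f :
  Ccont f -> (forall x, f x <> 0) -> Ccont (fun x => / f x).
Proof.
  intros Hf H0 x; specialize (Hf x).
  apply continuous_C_iff in Hf; destruct Hf as [Hr Hi].
  assert (Hd : continuous
    (fun y => / (Re (f y) ^ 2 + Im (f y) ^ 2))%R x).
  { apply (continuous_comp (fun y => (Re (f y) ^ 2 + Im (f y) ^ 2)%R) Rinv).
    - apply (continuous_plus (V := R_NormedModule)); cbn;
      repeat (apply (continuous_mult (K := R_AbsRing)); try assumption);
      apply continuous_const.
    - apply continuous_Rinv. rewrite <- Cmod2_alt.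
      apply pow_nonzero. intros H; apply (H0 x), Cmod_eq_0, H. }
  apply continuous_C_iff; split; cbn; unfold Rdiv;
  apply (continuous_mult (K := R_AbsRing)); try assumption.
  now apply (continuous_opp (V := R_NormedModule)).
Qed.

Lemma Ccont_comp (h : C -> C) f :
  Ccont h -> Ccont f -> Ccont (fun x => h (f x)).
Proof. intros Hh Hf x; apply continuous_comp; [apply Hf|apply Hh]. Qed.

End Continuity.

Lemma Ccont_id : Ccont (fun z : C => z).
Proof. intros x; apply continuous_id. Qed.

(** Coordinatewise, so that the real fundamental theorem of calculus and [auto_derive] apply;
    [has_tangent_eps] is the bridge to complex error bounds. *)
Definition has_tangent (F : R -> C) (t : R) (l : C) : Prop :=
  is_derive (fun s => Re (F s)) t (Re l) /\ is_derive (fun s => Im (F s)) t (Im l).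

(** An error bound instead of a difference quotient: the increment 0 needs no exception, and the
    version uniform in [w] arises by moving quantifiers. *)
Definition is_cderive (h : C -> C) (w l : C) : Prop :=
  forall eps, (0 < eps)%R -> exists del, (0 < del)%R /\
  forall v, (Cmod v < del)%R ->
    (Cmod (h (w + v) - h w - l * v)%C <= eps * Cmod v)%R.

Lemma is_derive_eps (f : R -> R) (t l : R) :
  is_derive f t l <->
  forall eps, (0 < eps)%R -> exists del, (0 < del)%R /\
  forall x, (Rabs x < del)%R ->
    (Rabs (f (t + x) - f t - l * x) <= eps * Rabs x)%R.
Proof.
  rewrite is_derive_Reals. split.
  - intros H eps He. destruct (H eps He) as [d Hd].
    exists d; split; [apply cond_pos|]; intros x Hx.
    destruct (Req_dec x 0) as [->|Hx0].
    { rewrite Rplus_0_r, Rmult_0_r, Rabs_R0.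
      replace (f t - f t - 0)%R with 0%R by ring. rewrite Rabs_R0; lra. }
    specialize (Hd x Hx0 Hx).
    replace (f (t + x) - f t - l * x)%R
      with (((f (t + x) - f t) / x - l) * x)%R by (field; assumption).
    rewrite Rabs_mult. apply Rmult_le_compat_r; [apply Rabs_pos|lra].
  - intros H eps He. assert (He' : (0 < eps / 2)%R) by lra.
    destruct (H _ He') as [d [Hd H']].
    exists (mkposreal d Hd); intros x Hx0 Hx; cbn in Hx.
    specialize (H' x Hx).
    replace ((f (t + x) - f t) / x - l)%R
      with ((f (t + x) - f t - l * x) / x)%R by (field; assumption).
    unfold Rdiv; rewrite Rabs_mult, Rabs_inv.
    assert (Hp := Rabs_pos_lt x Hx0).
    apply Rle_lt_trans with (eps / 2)%R; [|lra].
    apply Rmult_le_reg_r with (1 := Hp).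
    rewrite Rmult_assoc, Rinv_l by lra. lra.
Qed.

Lemma has_tangent_eps (F : R -> C) (t : R) (l : C) :
  has_tangent F t l <->
  forall eps, (0 < eps)%R -> exists del, (0 < del)%R /\
  forall x, (Rabs x < del)%R ->
    (Cmod (F (t + x)%R - F t - l * RtoC x)%C <= eps * Rabs x)%R.
Proof.
  assert (Er : forall x, (Re (F (t + x)) - Re (F t) - Re l * x)%R =
                         Re (F (t + x)%R - F t - l * RtoC x)).
  { intros x; cbn; unfold Re; ring. }
  assert (Ei : forall x, (Im (F (t + x)) - Im (F t) - Im l * x)%R =
                         Im (F (t + x)%R - F t - l * RtoC x)).
  { intros x; cbn; unfold Im; ring. }
  unfold has_tangent; rewrite !is_derive_eps. split.
  - intros [H1 H2] eps He. assert (He' : (0 < eps / 2)%R) by lra.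
    destruct (H1 _ He') as [d1 [Hd1 K1]], (H2 _ He') as [d2 [Hd2 K2]].
    exists (Rmin d1 d2); split; [now apply Rmin_glb_lt|].
    intros x Hx.
    assert (Hx1 := Rlt_le_trans _ _ _ Hx (Rmin_l _ _)).
    assert (Hx2 := Rlt_le_trans _ _ _ Hx (Rmin_r _ _)).
    specialize (K1 x Hx1); specialize (K2 x Hx2).
    rewrite Er in K1; rewrite Ei in K2.
    eapply Rle_trans; [apply Cmod_le_sum|lra].
  - intros H; split; intros eps He; destruct (H eps He) as [d [Hd K]];
    exists d; split; auto; intros x Hx; specialize (K x Hx);
    [rewrite Er|rewrite Ei]; eapply Rle_trans; try exact K;
    [apply re_le_Cmod|apply Im_le_Cmod].
Qed.

Lemma has_tangent_comp (h : C -> C) (F : R -> C) (t : R) (l m : C) :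
  is_cderive h (F t) m -> has_tangent F t l ->
  has_tangent (fun s => h (F s)) t (m * l).
Proof.
  rewrite !has_tangent_eps. intros Hh HF eps He.
  (* [A] collects the losses: the error is at most e1 (|l| + 1) |x| from [h] plus |m| e1 |x| from
     [F]. It also gives |v| <= A |x|, whence the bound d1 / A on |x|. *)
  set (A := (Cmod l + Cmod m + 2)%R).
  assert (HA : (0 < A)%R).
  { unfold A; generalize (Cmod_ge_0 l) (Cmod_ge_0 m); lra. }
  set (e1 := Rmin 1 (eps / A)).
  assert (He1 : (0 < e1)%R).
  { apply Rmin_glb_lt; [lra|]. apply Rdiv_lt_0_compat; assumption. }
  destruct (Hh e1 He1) as [d1 [Hd1 K1]], (HF e1 He1) as [d2 [Hd2 K2]].
  exists (Rmin d2 (d1 / A)); split.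
  { apply Rmin_glb_lt; [assumption|]. apply Rdiv_lt_0_compat; assumption. }
  intros x Hx.
  assert (Hx2 := Rlt_le_trans _ _ _ Hx (Rmin_l _ _)).
  assert (Hx1 := Rlt_le_trans _ _ _ Hx (Rmin_r _ _)).
  specialize (K2 x Hx2).
  set (v := F (t + x)%R - F t) in *.
  assert (Hv : (Cmod v <= (Cmod l + 1) * Rabs x)%R).
  { replace v with ((v - l * RtoC x) + l * RtoC x) by ring.
    eapply Rle_trans; [apply Cmod_triangle|].
    rewrite Cmod_mult, Cmod_R.
    assert (e1 <= 1)%R by apply Rmin_l.
    generalize (Rabs_pos x); nra. }
  assert (Hv1 : (Cmod v < d1)%R).
  { apply Rle_lt_trans with (A * Rabs x)%R.
    - eapply Rle_trans; [exact Hv|]. apply Rmult_le_compat_r; [apply Rabs_pos|].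
      unfold A; generalize (Cmod_ge_0 m); lra.
    - apply Rmult_lt_reg_r with (/ A)%R; [now apply Rinv_0_lt_compat|].
      replace (A * Rabs x * / A)%R with (Rabs x) by (field; lra). exact Hx1. }
  specialize (K1 v Hv1).
  replace (F t + v) with (F (t + x)%R) in K1 by (unfold v; ring).
  replace (h (F (t + x)%R) - h (F t) - m * l * RtoC x)
    with ((h (F (t + x)%R) - h (F t) - m * v) + m * (v - l * RtoC x)) by ring.
  eapply Rle_trans; [apply Cmod_triangle|]. rewrite Cmod_mult.
  assert (HeA : (e1 * A <= eps)%R).
  { assert (e1 <= eps / A)%R by apply Rmin_r.
    apply Rmult_le_reg_r with (/ A)%R; [now apply Rinv_0_lt_compat|].
    replace (e1 * A * / A)%R with e1 by (field; lra). assumption. }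
  apply Rle_trans with (e1 * A * Rabs x)%R; [|apply Rmult_le_compat_r; [apply Rabs_pos|assumption]].
  assert (e1 * Cmod v <= e1 * ((Cmod l + 1) * Rabs x))%R by (apply Rmult_le_compat_l; lra).
  assert (Cmod m * Cmod (v - l * RtoC x) <= Cmod m * (e1 * Rabs x))%R
    by (apply Rmult_le_compat_l; [apply Cmod_ge_0|assumption]).
  unfold A. generalize (Rabs_pos x). nra.
Qed.

Lemma is_cderive_continuous (h : C -> C) (w l : C) :
  is_cderive h w l -> continuous h w.
Proof.
  intros H. apply continuous_Cmod_iff; intros eps He.
  destruct (H 1%R Rlt_0_1) as [d [Hd K]].
  set (A := (Cmod l + 1)%R).
  assert (HA : (0 < A)%R) by (unfold A; generalize (Cmod_ge_0 l); lra).
  set (r := (Rmin d (eps / A) / 2)%R).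
  assert (Hr0 : (0 < Rmin d (eps / A))%R).
  { apply Rmin_glb_lt; [assumption|]. apply Rdiv_lt_0_compat; assumption. }
  assert (Hr : (0 < r)%R) by (unfold r; lra).
  exists (mkposreal r Hr); intros y [Hy1 Hy2].
  change (Rabs (Re (y - w)) < r)%R in Hy1.
  change (Rabs (Im (y - w)) < r)%R in Hy2.
  assert (Hv := Cmod_le_sum (y - w)).
  assert (Hm1 := Rmin_l d (eps / A)). assert (Hm2 := Rmin_r d (eps / A)).
  specialize (K (y - w)).
  assert (E : forall a b : C, a + (b - a) = b) by (intros; ring).
  rewrite E in K.
  assert (Hvd : (Cmod (y - w) < Rmin d (eps / A))%R) by (unfold r in *; lra).
  assert (K' := K ltac:(lra)).
  assert (H1 := Cmod_triangle (h y - h w - l * (y - w)) (l * (y - w))).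
  replace (h y - h w - l * (y - w) + l * (y - w)) with (h y - h w) in H1 by ring.
  rewrite Cmod_mult in H1.
  apply Rle_lt_trans with (A * Cmod (y - w))%R; [unfold A; lra|].
  apply Rmult_lt_reg_l with (/ A)%R; [now apply Rinv_0_lt_compat|].
  replace (/ A * (A * Cmod (y - w)))%R with (Cmod (y - w)) by (field; lra).
  unfold Rdiv in *. lra.
Qed.

Definition CInt (f : R -> C) (a b : R) : C :=
  (RInt (fun t => Re (f t)) a b, RInt (fun t => Im (f t)) a b).

Section Integral.
Implicit Types f g : R -> C.

Lemma Ccont_ex_RInt f a b : Ccont f ->
  ex_RInt (fun t => Re (f t)) a b /\ ex_RInt (fun t => Im (f t)) a b.
Proof.
  intros H; split; apply (ex_RInt_continuous (V := R_CompleteNormedModule)); intros t _;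
  specialize (H t); apply continuous_C_iff in H; apply H.
Qed.

(** Serves the norm estimate [CInt_le]: bounding the two coordinates separately would lose a
    constant factor. *)
Lemma CInt_is_RInt f a b : Ccont f ->
  is_RInt (V := C_R_NormedModule) f a b (CInt f a b).
Proof.
  intros H; destruct (Ccont_ex_RInt f a b H).
  apply (is_RInt_fct_extend_pair (U := R_NormedModule) (V := R_NormedModule));
  now apply (RInt_correct (V := R_CompleteNormedModule)).
Qed.

Lemma CInt_ext f g a b : (forall t, f t = g t) -> CInt f a b = CInt g a b.
Proof.
  intros E; unfold CInt; f_equal; apply RInt_ext; intros; now rewrite E.
Qed.

Lemma CInt_plus f g a b : Ccont f -> Ccont g ->
  CInt (fun t => f t + g t) a b = CInt f a b + CInt g a b.
Proof.
  intros Hf Hg; destruct (Ccont_ex_RInt f a b Hf), (Ccont_ex_RInt g a b Hg).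
  apply injective_projections; cbn;
  now apply (RInt_plus (V := R_CompleteNormedModule)).
Qed.

Lemma CInt_scal (c : C) f a b : Ccont f ->
  CInt (fun t => c * f t) a b = c * CInt f a b.
Proof.
  intros Hf; destruct (Ccont_ex_RInt f a b Hf) as [H1 H2].
  assert (S : forall (k : R) (u : R -> R), ex_RInt u a b ->
     RInt (fun t => k * u t)%R a b = (k * RInt u a b)%R)
    by (intros; now apply (RInt_scal (V := R_CompleteNormedModule))).
  assert (E : forall (k : R) (u : R -> R), ex_RInt u a b ->
     ex_RInt (fun t => k * u t)%R a b)
    by (intros; now apply (ex_RInt_scal (V := R_NormedModule))).
  apply injective_projections; cbn.
  - etransitivity; [apply (RInt_minus (V := R_CompleteNormedModule)); apply E; assumption|].
    apply (f_equal2 Rminus); apply S; assumption.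
  - etransitivity; [apply (RInt_plus (V := R_CompleteNormedModule)); apply E; assumption|].
    apply (f_equal2 Rplus); apply S; assumption.
Qed.

Lemma CInt_minus f g a b : Ccont f -> Ccont g ->
  CInt (fun t => f t - g t) a b = CInt f a b - CInt g a b.
Proof.
  intros Hf Hg.
  rewrite (CInt_ext _ (fun t => f t + (-1) * g t)) by (intros; ring).
  rewrite CInt_plus, CInt_scal; auto; [ring|].
  apply Ccont_mult; [apply Ccont_const|assumption].
Qed.

Lemma CInt_const (c : C) a b : CInt (fun _ => c) a b = c * RtoC (b - a).
Proof.
  unfold CInt; rewrite !RInt_const; apply injective_projections; cbn;
  unfold scal, mult; cbn; unfold mult; cbn; unfold Re, Im; ring.
Qed.

Lemma CInt_Chasles f a b c : Ccont f ->
  CInt f a b + CInt f b c = CInt f a c.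
Proof.
  intros Hf; destruct (Ccont_ex_RInt f a b Hf), (Ccont_ex_RInt f b c Hf).
  apply injective_projections; cbn;
  now apply (RInt_Chasles (V := R_CompleteNormedModule)).
Qed.

Lemma CInt_le f a b (M : R) : Ccont f ->
  (forall t, (Rmin a b <= t <= Rmax a b)%R -> (Cmod (f t) <= M)%R) ->
  (Cmod (CInt f a b) <= Rabs (b - a) * M)%R.
Proof.
  intros Hf HM. rewrite Cmod_norm.
  apply (norm_RInt_le_const_abs (V := C_R_NormedModule) f a b).
  - intros t Ht. rewrite <- Cmod_norm. now apply HM.
  - now apply CInt_is_RInt.
Qed.

Lemma CInt_FTC (F f : R -> C) a b :
  (forall t, has_tangent F t (f t)) -> Ccont f ->
  CInt f a b = F b - F a.
Proof.
  intros HF Hf.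
  assert (Hc : forall t, continuous (fun s => Re (f s)) t /\ continuous (fun s => Im (f s)) t)
    by (intros t; apply continuous_C_iff, Hf).
  apply injective_projections;
  [apply (is_RInt_unique (V := R_CompleteNormedModule) (fun t => Re (f t)) a b
     (Re (F b) - Re (F a))%R), (is_RInt_derive (fun t => Re (F t)))
  |apply (is_RInt_unique (V := R_CompleteNormedModule) (fun t => Im (f t)) a b
     (Im (F b) - Im (F a))%R), (is_RInt_derive (fun t => Im (F t)))];
  intros t _; apply HF || apply Hc.
Qed.

End Integral.

(** * Goursat's lemma for rectangles *)

(** The intervals with centre [u n] and radius K / 2^n are nested, since each step is at most the
    decrease of the radius; [l] is the supremum of their left ends. *)
Lemma halving_limit (u : nat -> R) (K : R) :
  (forall n, (Rabs (u (S n) - u n) <= K / 2 ^ S n)%R) ->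
  exists l, forall n, (Rabs (u n - l) <= K / 2 ^ n)%R.
Proof.
  intros H.
  assert (HS : forall n, (K / 2 ^ n = 2 * (K / 2 ^ S n))%R).
  { intros n; cbn; field; apply pow_nonzero; lra. }
  assert (H' : forall n k, (u n - K / 2 ^ n <= u (n + k)%nat - K / 2 ^ (n + k)
     /\ u (n + k)%nat + K / 2 ^ (n + k) <= u n + K / 2 ^ n)%R).
  { intros n k; induction k as [|k IH]; [rewrite Nat.add_0_r; lra|].
    rewrite Nat.add_succ_r. specialize (H (n + k)%nat). specialize (HS (n + k)%nat).
    apply Rabs_le_between in H. lra. }
  assert (HK : forall n, (0 <= K / 2 ^ n)%R).
  { intros n. specialize (H n). rewrite HS.
    generalize (Rabs_pos (u (S n) - u n)); lra. }
  assert (Hup : forall m n, (u n - K / 2 ^ n <= u m + K / 2 ^ m)%R).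
  { intros m n. destruct (H' n m) as [H1 _], (H' m n) as [_ H2].
    rewrite Nat.add_comm in H2. specialize (HK (n + m)%nat). lra. }
  destruct (completeness (fun x => exists n, x = (u n - K / 2 ^ n)%R)) as [l [Hl1 Hl2]].
  - exists (u 0%nat + K / 2 ^ 0)%R; intros x [n ->]; apply Hup.
  - now exists (u 0%nat - K / 2 ^ 0)%R, 0%nat.
  - exists l; intros n. apply Rabs_le_between. split.
    + assert (l <= u n + K / 2 ^ n)%R; [|lra].
      apply Hl2; intros x [m ->]; apply Hup.
    + assert (u n - K / 2 ^ n <= l)%R; [|lra].
      apply Hl1; now exists n.
Qed.

Record rect := Rect { left : R; right : R; bottom : R; top : R }.

(** All four quarters of [r] satisfy this, and it is all that convergence of the corners needs,
    whichever quarter is chosen. *)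
Definition half_of (r r' : rect) : Prop :=
  (right r' - left r' = (right r - left r) / 2 /\
   top r' - bottom r' = (top r - bottom r) / 2 /\
   Rabs (left r' - left r) <= Rabs (right r - left r) / 2 /\
   Rabs (bottom r' - bottom r) <= Rabs (top r - bottom r) / 2)%R.

Definition size (r : rect) : R :=
  (Rabs (right r - left r) + Rabs (top r - bottom r))%R.

(* Rectangles are oriented: [right < left] and [top < bottom] are allowed. *)
Lemma rect_bisection (Q : rect -> Prop) :
  (forall a b c d, let m := ((a + b) / 2)%R in let n := ((c + d) / 2)%R in
    Q (Rect a m c n) -> Q (Rect m b c n) -> Q (Rect a m n d) -> Q (Rect m b n d) ->
    Q (Rect a b c d)) ->
  (forall p q : R, exists del, (0 < del)%R /\ forall r,
    (Rabs (left r - p) <= Rabs (right r - left r))%R ->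
    (Rabs (bottom r - q) <= Rabs (top r - bottom r))%R ->
    (size r < del)%R -> Q r) ->
  forall r, Q r.
Proof.
  intros Hsplit Hloc r0. apply NNPP; intros Hr0.
  (* On the subtype of bad rectangles choice gives a map from the type to itself, which can be
     iterated. *)
  assert (Hnext : forall r : {r | ~ Q r}, exists r' : {r | ~ Q r},
     half_of (proj1_sig r) (proj1_sig r')).
  { intros [[a b c d] Hr]; cbn.
    set (m := ((a + b) / 2)%R); set (n := ((c + d) / 2)%R).
    assert (half_of (Rect a b c d) (Rect a m c n) /\ half_of (Rect a b c d) (Rect m b c n)
      /\ half_of (Rect a b c d) (Rect a m n d) /\ half_of (Rect a b c d) (Rect m b n d))
      as [K1 [K2 [K3 K4]]].
    { unfold half_of, m, n; cbn.
      replace ((a + b) / 2 - a)%R with ((b - a) / 2)%R by field.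
      replace ((c + d) / 2 - c)%R with ((d - c) / 2)%R by field.
      rewrite !Rminus_diag, Rabs_R0, !(Rabs_div _ 2), (Rabs_pos_eq 2) by lra.
      generalize (Rabs_pos (b - a)) (Rabs_pos (d - c)); repeat split; try lra; field. }
    apply NNPP; intros HN; apply Hr, Hsplit; apply NNPP; intros HQ; apply HN;
    now exists (exist (fun r => ~ Q r) _ HQ). }
  pose (next r := proj1_sig (constructive_indefinite_description _ (Hnext r))).
  assert (Hn : forall r, half_of (proj1_sig r) (proj1_sig (next r))).
  { intros r; unfold next; now destruct (constructive_indefinite_description _ _). }
  clearbody next.
  pose (s n := Nat.iter n next (exist _ r0 Hr0)).
  assert (Hs : forall n, half_of (proj1_sig (s n)) (proj1_sig (s (S n)))) by (intros; apply Hn).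
  assert (HQ : forall n, ~ Q (proj1_sig (s n))) by (intros; apply proj2_sig).
  set (r n := proj1_sig (s n)) in *.
  assert (E0 : r 0%nat = r0) by reflexivity.
  change (forall n, half_of (r n) (r (S n))) in Hs.
  change (forall n, ~ Q (r n)) in HQ.
  clearbody r. clear s next Hn Hnext.
  assert (W : forall n, (right (r n) - left (r n) = (right r0 - left r0) / 2 ^ n /\
    top (r n) - bottom (r n) = (top r0 - bottom r0) / 2 ^ n)%R).
  { induction n as [|n [IH1 IH2]]; [rewrite E0; cbn; lra|].
    destruct (Hs n) as [-> [-> _]]. rewrite IH1, IH2.
    assert (2 ^ n <> 0)%R by (apply pow_nonzero; lra). cbn; split; field; assumption. }
  assert (W' : forall x n, (Rabs (x / 2 ^ n) = Rabs x / 2 ^ n)%R).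
  { intros x n. assert (0 < 2 ^ n)%R by (apply pow_lt; lra).
    rewrite Rabs_div, (Rabs_pos_eq (2 ^ n)); lra. }
  assert (Eh : forall x n, (x / 2 ^ n / 2 = x / 2 ^ S n)%R).
  { intros x n. assert (2 ^ n <> 0)%R by (apply pow_nonzero; lra). cbn; field; assumption. }
  (* The distance from the n-th corner to the limit is at most the n-th side length, which is the
     form of proximity required by the local hypothesis on [Q]. *)
  destruct (halving_limit (fun n => left (r n)) (Rabs (right r0 - left r0))) as [p Hp].
  { intros n. destruct (Hs n) as [_ [_ [H _]]], (W n) as [Hw _].
    rewrite Hw, W', Eh in H. exact H. }
  destruct (halving_limit (fun n => bottom (r n)) (Rabs (top r0 - bottom r0))) as [q Hq].
  { intros n. destruct (Hs n) as [_ [_ [_ H]]], (W n) as [_ Hw].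
    rewrite Hw, W', Eh in H. exact H. }
  destruct (Hloc p q) as [del [Hdel Hd]].
  set (K := (Rabs (right r0 - left r0) + Rabs (top r0 - bottom r0) + 1)%R).
  assert (HK : (0 < K)%R).
  { unfold K; generalize (Rabs_pos (right r0 - left r0)) (Rabs_pos (top r0 - bottom r0)); lra. }
  destruct (pow_lt_1_zero (/ 2) ltac:(rewrite Rabs_pos_eq; lra) (del / K)
     ltac:(now apply Rdiv_lt_0_compat)) as [N HN].
  specialize (HN N (Nat.le_refl _)).
  apply (HQ N), Hd; destruct (W N) as [W1 W2].
  - rewrite W1, W'. apply Hp.
  - rewrite W2, W'. apply Hq.
  - unfold size; rewrite W1, W2, !W'.
    rewrite pow_inv, Rabs_pos_eq in HN
      by (apply Rlt_le, Rinv_0_lt_compat, pow_lt; lra).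
    apply Rlt_le_trans with (K * / 2 ^ N)%R.
    + assert (0 < / 2 ^ N)%R by (apply Rinv_0_lt_compat, pow_lt; lra).
      unfold Rdiv, K. nra.
    + replace del with (K * (del / K))%R by (field; lra).
      apply Rmult_le_compat_l; lra.
Qed.

(** The integral of h dz along the boundary, counterclockwise if a < b and c < d; [Ci] comes from dz
    = i dy on the vertical sides. *)
Definition rect_int (h : C -> C) (r : rect) : C :=
  let '(Rect a b c d) := r in
  CInt (fun x => h (x, c)) a b - CInt (fun x => h (x, d)) a b +
  Ci * (CInt (fun y => h (b, y)) c d - CInt (fun y => h (a, y)) c d).

Lemma Ccont_horizontal (c : R) : Ccont (fun x : R => ((x, c) : C)).
Proof.
  intros x; apply continuous_C_iff; split; [apply continuous_id|apply continuous_const].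
Qed.

Lemma Ccont_vertical (a : R) : Ccont (fun y : R => ((a, y) : C)).
Proof.
  intros x; apply continuous_C_iff; split; [apply continuous_const|apply continuous_id].
Qed.

Lemma Ccont_comp_horizontal (h : C -> C) (c : R) : Ccont h -> Ccont (fun x : R => h (x, c)).
Proof. intros H; apply (Ccont_comp h); [exact H|apply Ccont_horizontal]. Qed.

Lemma Ccont_comp_vertical (h : C -> C) (a : R) : Ccont h -> Ccont (fun y : R => h (a, y)).
Proof. intros H; apply (Ccont_comp h); [exact H|apply Ccont_vertical]. Qed.

#[local] Hint Resolve Ccont_comp_horizontal Ccont_comp_vertical : core.

Lemma rect_int_split (h : C -> C) (a m b c n d : R) : Ccont h ->
  rect_int h (Rect a b c d) =
  rect_int h (Rect a m c n) + rect_int h (Rect m b c n) +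
  rect_int h (Rect a m n d) + rect_int h (Rect m b n d).
Proof.
  intros H; cbn.
  rewrite <- (CInt_Chasles (fun x => h (x, c)) a m b) by auto.
  rewrite <- (CInt_Chasles (fun x => h (x, d)) a m b) by auto.
  rewrite <- (CInt_Chasles (fun y => h (a, y)) c n d) by auto.
  rewrite <- (CInt_Chasles (fun y => h (b, y)) c n d) by auto.
  ring.
Qed.

Lemma rect_int_minus (h k : C -> C) (r : rect) : Ccont h -> Ccont k ->
  rect_int (fun z => h z - k z) r = rect_int h r - rect_int k r.
Proof.
  intros Hh Hk; destruct r as [a b c d]; cbn.
  rewrite (CInt_minus (fun x => h (x, c)) (fun x => k (x, c))) by auto.
  rewrite (CInt_minus (fun x => h (x, d)) (fun x => k (x, d))) by auto.
  rewrite (CInt_minus (fun x => h (a, x)) (fun x => k (a, x))) by auto.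
  rewrite (CInt_minus (fun x => h (b, x)) (fun x => k (b, x))) by auto.
  ring.
Qed.

Lemma has_tangent_horizontal (c t : R) : has_tangent (fun x => (x, c)) t 1.
Proof. split; cbn; auto_derive; auto. Qed.

Lemma has_tangent_vertical (a t : R) : has_tangent (fun y => (a, y)) t Ci.
Proof. split; cbn; auto_derive; auto. Qed.

Lemma rect_int_primitive (H h : C -> C) (r : rect) :
  (forall w, is_cderive H w (h w)) -> Ccont h -> rect_int h r = 0.
Proof.
  intros HH Hh; destruct r as [a b c d]; cbn.
  assert (X : forall y, CInt (fun x => h (x, y)) a b = H (b, y) - H (a, y)).
  { intros y. apply (CInt_FTC (fun x => H (x, y))); auto. intros t.
    replace (h (t, y)) with (h (t, y) * 1) by ring.
    apply (has_tangent_comp H (fun x => (x, y))); [apply HH|apply has_tangent_horizontal]. }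
  assert (Y : forall x, Ci * CInt (fun y => h (x, y)) c d = H (x, d) - H (x, c)).
  { intros x. rewrite <- CInt_scal by auto.
    apply (CInt_FTC (fun y => H (x, y))).
    - intros t. replace (Ci * h (x, t)) with (h (x, t) * Ci) by ring.
      apply (has_tangent_comp H (fun y => (x, y))); [apply HH|apply has_tangent_vertical].
    - apply Ccont_mult; [apply Ccont_const|auto]. }
  rewrite !X.
  replace (Ci * (CInt (fun y => h (b, y)) c d - CInt (fun y => h (a, y)) c d))
    with (Ci * CInt (fun y => h (b, y)) c d - Ci * CInt (fun y => h (a, y)) c d) by ring.
  rewrite !Y. ring.
Qed.

Lemma rect_int_affine (p q : C) (r : rect) : rect_int (fun z => p + q * z) r = 0.
Proof.
  apply (rect_int_primitive (fun z => p * z + q / 2 * (z * z))).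
  - intros w eps He. set (A := (Cmod (q / 2) + 1)%R).
    assert (HA : (0 < A)%R) by (unfold A; generalize (Cmod_ge_0 (q / 2)); lra).
    exists (eps / A)%R; split; [now apply Rdiv_lt_0_compat|]. intros v Hv.
    replace (p * (w + v) + q / 2 * ((w + v) * (w + v)) - (p * w + q / 2 * (w * w)) - (p + q * w) * v)
      with (q / 2 * v * v).
    2: { field. }
    rewrite !Cmod_mult. apply Rmult_le_compat_r; [apply Cmod_ge_0|].
    apply Rle_trans with (A * (eps / A))%R; [|right; field; lra].
    apply Rmult_le_compat; try apply Cmod_ge_0; unfold A in *; lra.
  - apply Ccont_plus; [apply Ccont_const|].
    apply Ccont_mult; [apply Ccont_const|apply Ccont_id].
Qed.

(** The factor [2 * size r] is the perimeter. *)
Lemma rect_int_le (h : C -> C) (r : rect) (M : R) : Ccont h ->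
  (forall x y, (Rmin (left r) (right r) <= x <= Rmax (left r) (right r))%R ->
     (Rmin (bottom r) (top r) <= y <= Rmax (bottom r) (top r))%R ->
     (Cmod (h (x, y)) <= M)%R) ->
  (Cmod (rect_int h r) <= 2 * size r * M)%R.
Proof.
  intros Hh HM; destruct r as [a b c d]; unfold size; cbn in *.
  assert (B : forall u v, (Rmin u v <= u <= Rmax u v)%R /\ (Rmin u v <= v <= Rmax u v)%R).
  { intros u v; generalize (Rmin_l u v) (Rmin_r u v) (Rmax_l u v) (Rmax_r u v); lra. }
  assert (Ba := B a b). assert (Bc := B c d).
  assert (I1 := CInt_le (fun x => h (x, c)) a b M ltac:(auto) ltac:(intros; now apply HM)).
  assert (I2 := CInt_le (fun x => h (x, d)) a b M ltac:(auto) ltac:(intros; now apply HM)).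
  assert (I3 := CInt_le (fun y => h (a, y)) c d M ltac:(auto) ltac:(intros; now apply HM)).
  assert (I4 := CInt_le (fun y => h (b, y)) c d M ltac:(auto) ltac:(intros; now apply HM)).
  assert (T : forall u v, (Cmod (u - v) <= Cmod u + Cmod v)%R).
  { intros u v. rewrite <- (Cmod_opp v). apply Cmod_triangle. }
  eapply Rle_trans; [apply Cmod_triangle|].
  rewrite Cmod_mult, Cmod_Ci, Rmult_1_l.
  eapply Rle_trans; [apply Rplus_le_compat; apply T|]. lra.
Qed.

Lemma Rabs_near_endpoint (a b x p : R) : (Rabs (a - p) <= Rabs (b - a) ->
  Rmin a b <= x <= Rmax a b -> Rabs (x - p) <= 2 * Rabs (b - a))%R.
Proof.
  unfold Rmin, Rmax; destruct (Rle_dec a b); unfold Rabs; repeat destruct Rcase_abs; lra.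
Qed.

(** The bound eps size^2 is what bisection preserves: four quarters of half the size add up to
    exactly the same bound. Near a point it holds because the affine part of [h] integrates to 0,
    leaving perimeter times a first-order error. *)
Lemma Goursat_rectangle (h : C -> C) (r : rect) :
  (forall w, exists l, is_cderive h w l) -> rect_int h r = 0.
Proof.
  intros Hd.
  assert (Hh : Ccont h).
  { intros w; destruct (Hd w) as [l Hl]. exact (is_cderive_continuous h w l Hl). }
  assert (HQ : forall eps, (0 < eps)%R -> (Cmod (rect_int h r) <= eps * size r ^ 2)%R).
  { intros eps He; revert r; apply rect_bisection.
    - intros a b c d m n; rewrite (rect_int_split h a m b c n d Hh).
      assert (S : forall u v, (Rabs ((u + v) / 2 - u) = Rabs (v - u) / 2)%R /\
                              (Rabs (v - (u + v) / 2) = Rabs (v - u) / 2)%R).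
      { intros u v. rewrite <- (Rabs_pos_eq 2) at 2 4 by lra. rewrite <- !Rabs_div by lra.
        split; f_equal; field. }
      unfold size, m, n; cbn -[rect_int Cplus Rmult Rplus]; rewrite !(proj1 (S _ _)), !(proj2 (S _ _)).
      set (s := Rabs (b - a)); set (t := Rabs (d - c)).
      intros H1 H2 H3 H4.
      eapply Rle_trans; [apply Cmod_triangle|].
      eapply Rle_trans; [apply Rplus_le_compat_r, Cmod_triangle|].
      eapply Rle_trans; [apply Rplus_le_compat_r, Rplus_le_compat_r, Cmod_triangle|].
      nra.
    - intros x0 y0. set (p := (x0, y0) : C).
      destruct (Hd p) as [l Hl].
      assert (He' : (0 < eps / 4)%R) by lra.
      destruct (Hl _ He') as [del [Hdel K]].
      (* Points of [r] lie within 2 size of [p], so the integral is at most the perimeter 2 size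
         times (eps / 4) (2 size), that is eps size^2. *)
      exists (del / 2)%R; split; [lra|]. intros r H1 H2 H3.
      replace (rect_int h r) with
        (rect_int (fun z => h z - ((h p - l * p) + l * z)) r).
      2: { rewrite rect_int_minus, rect_int_affine; [ring|exact Hh|].
           apply Ccont_plus; [apply Ccont_const|].
           apply Ccont_mult; [apply Ccont_const|apply Ccont_id]. }
      apply Rle_trans with (2 * size r * (eps / 4 * (2 * size r)))%R; [|right; field].
      apply rect_int_le.
      { apply Ccont_minus; [exact Hh|]. apply Ccont_plus; [apply Ccont_const|].
        apply Ccont_mult; [apply Ccont_const|apply Ccont_id]. }
      intros x y Hx Hy.
      set (v := (x, y) - p).
      assert (Hv : (Cmod v <= 2 * size r)%R).
      { eapply Rle_trans; [apply Cmod_le_sum|].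
        change (Rabs (x - x0) + Rabs (y - y0) <= 2 * size r)%R.
        unfold size. destruct r as [a b c d]; cbn in *.
        assert (B1 := Rabs_near_endpoint a b x x0 H1 Hx). assert (B2 := Rabs_near_endpoint c d y y0 H2 Hy). lra. }
      specialize (K v ltac:(lra)).
      assert (E : h (x, y) - (h p - l * p + l * (x, y)) = h (p + v) - h p - l * v).
      { unfold v. generalize ((x, y) : C); intros z.
        replace (p + (z - p)) with z by ring. ring. }
      rewrite E.
      nra. }
  apply Cmod_eq_0. apply Rle_antisym; [|apply Cmod_ge_0].
  apply le_epsilon; intros eps He.
  assert (Hs : (0 <= size r ^ 2)%R) by apply pow2_ge_0.
  eapply Rle_trans; [apply (HQ (eps / (size r ^ 2 + 1))%R); apply Rdiv_lt_0_compat; lra|].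
  rewrite Rplus_0_l.
  apply Rmult_le_reg_r with (size r ^ 2 + 1)%R; [lra|].
  replace (eps / (size r ^ 2 + 1) * size r ^ 2 * (size r ^ 2 + 1))%R
    with (eps * size r ^ 2)%R by (field; lra). nra.
Qed.

(** * Compactness and primitives *)

(** Compactness as in Cousin's lemma. [P t del] says that the radius [del] is admissible at [t]; a
    relation in place of a radius function avoids choice. The centres of the finite cover may lie
    outside [K]. *)
Definition gauge_compact {T : UniformSpace} (K : T -> Prop) : Prop :=
  forall P : T -> posreal -> Prop, (forall t, exists del, P t del) ->
  exists l, (forall p, In p l -> P (fst p) (snd p)) /\
    forall x, K x -> exists p, In p l /\ ball (fst p) (snd p) x.

Lemma list_lower_bound {A : Type} (phi : A -> posreal) (l : list A) :
  exists eta : posreal, forall p, In p l -> (eta <= phi p)%R.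
Proof.
  induction l as [|p l [eta IH]]; [exists (mkposreal 1 Rlt_0_1); intros ? []|].
  assert (H : (0 < Rmin eta (phi p))%R) by (apply Rmin_glb_lt; apply cond_pos).
  exists (mkposreal _ H); cbn; intros q [<-|Hq]; [apply Rmin_r|].
  eapply Rle_trans; [apply Rmin_l|auto].
Qed.

Lemma list_upper_bound {A : Type} (phi : A -> R) (l : list A) :
  exists M : R, forall p, In p l -> (phi p <= M)%R.
Proof.
  induction l as [|p l [M IH]]; [exists 0%R; intros ? []|].
  exists (Rmax M (phi p)); cbn; intros q [<-|Hq]; [apply Rmax_r|].
  eapply Rle_trans; [eauto|apply Rmax_l].
Qed.

(** Tube lemma: over each [t] finitely many balls cover [L], and the least of their radii is
    declared admissible at [t] for a cover of [K]. *)
Lemma gauge_compact_prod {T U : UniformSpace} (K : T -> Prop) (L : U -> Prop) :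
  gauge_compact K -> gauge_compact L ->
  gauge_compact (fun p : T * U => K (fst p) /\ L (snd p)).
Proof.
  intros HK HL P HP.
  pose (Q t (eta : posreal) := exists l : list (U * posreal),
    (forall p, In p l -> P (t, fst p) (snd p) /\ (eta <= snd p)%R) /\
    forall x, L x -> exists p, In p l /\ ball (fst p) (snd p) x).
  destruct (HK Q) as [l [Hl Hcov]].
  { intros t. destruct (HL (fun u => P (t, u)) (fun u => HP (t, u))) as [l [Hl Hcov]].
    destruct (list_lower_bound snd l) as [eta Heta].
    exists eta, l; split; [intros; split|]; auto. }
  (* The covers over the centres in [l] are only known to exist, so they are merged by induction on
     [l]. *)
  assert (HQ : exists m : list (T * U * posreal),
    (forall p, In p m -> P (fst p) (snd p)) /\
    forall p x u, In p l -> ball (fst p) (snd p) x -> L u ->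
      exists q, In q m /\ ball (fst q) (snd q) (x, u)).
  { clear Hcov; induction l as [|p l IH].
    { exists nil; split; [intros ? []|intros ? ? ? []]. }
    destruct IH as [m [Hm1 Hm2]]; [intros; apply Hl; now right|].
    destruct (Hl p (or_introl eq_refl)) as [lu [Hlu Hcu]].
    exists (map (fun q => ((fst p, fst q), snd q)) lu ++ m); split.
    - intros q Hq; apply in_app_or in Hq as [Hq|Hq]; [|auto].
      apply in_map_iff in Hq as [q' [<- Hq]]; now apply Hlu.
    - intros p' x u [<-|Hp'] Hx Hu.
      + destruct (Hcu u Hu) as [q [Hq1 Hq2]].
        exists ((fst p, fst q), snd q); split.
        * apply in_or_app; left; apply in_map_iff; now exists q.
        * split; [|exact Hq2]. apply (ball_le _ (snd p)); [now apply Hlu|exact Hx].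
      + destruct (Hm2 p' x u Hp' Hx Hu) as [q [Hq1 Hq2]].
        exists q; split; [apply in_or_app; now right|assumption]. }
  destruct HQ as [m [Hm1 Hm2]]; exists m; split; [assumption|].
  intros [x u] [Hx Hu]; destruct (Hcov x Hx) as [p [Hp1 Hp2]]; eauto.
Qed.

Definition box (rho : R) (z : C) : Prop := (Rabs (Re z) <= rho /\ Rabs (Im z) <= rho)%R.

Lemma Cmod_box (rho : R) (z : C) : (Cmod z <= rho)%R -> box rho z.
Proof.
  intros H; split; (eapply Rle_trans; [|exact H]); [apply re_le_Cmod|apply Im_le_Cmod].
Qed.

Lemma gauge_compact_box (rho : R) : gauge_compact (box rho).
Proof.
  intros P HP.
  assert (H := rect_bisection (fun r => exists l : list (C * posreal),
    (forall p, In p l -> P (fst p) (snd p)) /\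
    forall x y, (Rmin (left r) (right r) <= x <= Rmax (left r) (right r))%R ->
     (Rmin (bottom r) (top r) <= y <= Rmax (bottom r) (top r))%R ->
     exists p, In p l /\ ball (fst p) (snd p) ((x, y) : C))).
  destruct H with (r := Rect (- rho) rho (- rho) rho) as [l [Hl Hc]]; cbn in *.
  - intros a b c d [l1 [K1 L1]] [l2 [K2 L2]] [l3 [K3 L3]] [l4 [K4 L4]].
    exists (l1 ++ l2 ++ l3 ++ l4); split.
    + intros p Hp; repeat (apply in_app_or in Hp as [Hp|Hp]; auto).
    + intros x y Hx Hy.
      assert (B : forall u v t, (Rmin u v <= t <= Rmax u v)%R ->
        (Rmin u ((u + v) / 2) <= t <= Rmax u ((u + v) / 2))%R \/
        (Rmin ((u + v) / 2) v <= t <= Rmax ((u + v) / 2) v)%R).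
      { intros u v t; unfold Rmin, Rmax; repeat destruct Rle_dec; intros Ht;
        destruct (Rle_dec t ((u + v) / 2)); try (left; lra); right; lra. }
      destruct (B _ _ _ Hx) as [Hx'|Hx'], (B _ _ _ Hy) as [Hy'|Hy'];
      [destruct (L1 x y Hx' Hy') as [p [Hp Hb]]|destruct (L3 x y Hx' Hy') as [p [Hp Hb]]
      |destruct (L2 x y Hx' Hy') as [p [Hp Hb]]|destruct (L4 x y Hx' Hy') as [p [Hp Hb]]];
      exists p; split; auto; rewrite !in_app_iff; tauto.
  - intros p q. destruct (HP (p, q)) as [del Hdel].
    (* A rectangle this small near (p, q) lies in the single ball of radius [del]; halving makes up
       for the factor 2 in [Rabs_near_endpoint]. *)
    exists (del / 2)%R; split; [generalize (cond_pos del); lra|].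
    intros [a b c d] H1 H2 H3; unfold size in H3; cbn in *.
    exists ((p, q, del) :: nil); split; [intros ? [<-|[]]; exact Hdel|].
    intros x y Hx Hy; exists (p, q, del); split; [now left|].
    generalize (Rabs_pos (b - a)) (Rabs_pos (d - c)); intros.
    split; cbn.
    + change (Rabs (x - p) < del)%R. generalize (Rabs_near_endpoint a b x p H1 Hx). lra.
    + change (Rabs (y - q) < del)%R. generalize (Rabs_near_endpoint c d y q H2 Hy). lra.
  - exists l; split; [assumption|]. intros [x y] [Hx Hy].
    assert (B : forall t, (Rabs t <= rho)%R -> (Rmin (- rho) rho <= t <= Rmax (- rho) rho)%R).
    { intros t Ht; apply Rabs_le_between in Ht.
      unfold Rmin, Rmax; destruct Rle_dec; lra. }
    apply Hc; now apply B.
Qed.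

Lemma Ccont_bounded {T : UniformSpace} (K : T -> Prop) (f : T -> C) :
  gauge_compact K -> Ccont f -> exists M, (0 < M)%R /\ forall x, K x -> (Cmod (f x) <= M)%R.
Proof.
  intros HK Hf.
  destruct (HK (fun t del => forall x, ball t del x -> (Cmod (f x) <= Cmod (f t) + 1)%R))
    as [l [Hl Hc]].
  { intros t. specialize (Hf t).
    destruct (proj1 (continuous_Cmod_iff f t) Hf 1%R Rlt_0_1) as [del Hdel].
    exists del; intros x Hx. specialize (Hdel x Hx).
    generalize (Cmod_triangle_inv (f x) (f t)); lra. }
  destruct (list_upper_bound (fun p => (Cmod (f (fst p)) + 1)%R) l) as [M HM].
  exists (Rabs M + 1)%R; split; [generalize (Rabs_pos M); lra|].
  intros x Hx; destruct (Hc x Hx) as [p [Hp1 Hp2]].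
  generalize (Hl p Hp1 x Hp2) (HM p Hp1) (Rle_abs M); lra.
Qed.

Lemma ball_C (z w : C) (eps : R) : (Cmod (w - z) < eps)%R -> ball z eps w.
Proof.
  intros H; split;
  [apply Rle_lt_trans with (2 := H); exact (re_le_Cmod (w - z))
  |apply Rle_lt_trans with (2 := H); exact (Im_le_Cmod (w - z))].
Qed.

(** Lebesgue number argument: the gauge at [t] is half a radius on which [h] varies little, so a
    point close to [w] stays in the doubled ball that contains [w]. Only [w] is confined to the
    disk. *)
Lemma Ccont_uniformly (h : C -> C) (rho eps : R) : Ccont h -> (0 < eps)%R ->
  exists del, (0 < del)%R /\ forall w z, (Cmod w <= rho)%R -> (Cmod (z - w) < del)%R ->
    (Cmod (h z - h w) <= eps)%R.
Proof.
  intros Hh He.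
  destruct (gauge_compact_box rho (fun t del => forall x : C, ball t (2 * del)%R x ->
     (Cmod (h x - h t) < eps / 2)%R)) as [l [Hl Hc]].
  { intros t. specialize (Hh t).
    destruct (proj1 (continuous_Cmod_iff h t) Hh (eps / 2)%R ltac:(lra)) as [del Hdel].
    exists (pos_div_2 del); intros x Hx; apply Hdel; cbn in Hx.
    replace (2 * (del / 2))%R with (pos del) in Hx by field. exact Hx. }
  destruct (list_lower_bound snd l) as [del Hdel].
  exists del; split; [apply cond_pos|]. intros w z Hw Hz.
  destruct (Hc w (Cmod_box _ _ Hw)) as [p [Hp1 Hp2]].
  assert (H1 : (Cmod (h w - h (fst p)) < eps / 2)%R).
  { apply (Hl p Hp1). apply (ball_le _ (snd p)); [generalize (cond_pos (snd p)); lra|exact Hp2]. }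
  assert (H2 : (Cmod (h z - h (fst p)) < eps / 2)%R).
  { apply (Hl p Hp1). replace (2 * snd p)%R with (snd p + snd p)%R by ring.
    apply (ball_triangle _ w); [exact Hp2|]. apply ball_C.
    specialize (Hdel p Hp1); lra. }
  replace (h z - h w) with ((h z - h (fst p)) + - (h w - h (fst p))) by ring.
  eapply Rle_trans; [apply Cmod_triangle|]. rewrite Cmod_opp. lra.
Qed.

(* Uniformity is on bounded sets. *)
Definition uniform_derivative (H h : C -> C) : Prop :=
  Ccont h /\ forall rho eps, (0 < eps)%R -> exists del, (0 < del)%R /\
  forall w v, (Cmod w <= rho)%R -> (Cmod v < del)%R ->
    (Cmod (H (w + v) - H w - h w * v)%C <= eps * Cmod v)%R.

Lemma uniform_derivative_is_cderive (H h : C -> C) (w : C) :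
  uniform_derivative H h -> is_cderive H w (h w).
Proof.
  intros [_ HH] eps He. destruct (HH (Cmod w) eps He) as [del [Hdel K]].
  exists del; split; [assumption|]. intros v Hv; apply K; auto; apply Rle_refl.
Qed.

Definition differentiable (h : C -> C) : Prop := forall w, exists l, is_cderive h w l.

Lemma differentiable_Ccont (h : C -> C) : differentiable h -> Ccont h.
Proof.
  intros H w; destruct (H w) as [l Hl]. exact (is_cderive_continuous h w l Hl).
Qed.

Lemma differentiable_ext (h k : C -> C) :
  (forall w, h w = k w) -> differentiable h -> differentiable k.
Proof.
  intros E H w; destruct (H w) as [l Hl]; exists l; intros eps He.
  destruct (Hl eps He) as [d [Hd K]]; exists d; split; [assumption|].
  intros v Hv; rewrite <- !E; auto.
Qed.

(** The primitive integrates along the real axis and then vertically. By Goursat its increment is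
    the integral over a short path from [w] to w + v, horizontal then vertical, on which [h] stays
    within eps / 2 of [h w], uniformly for bounded [w]. *)
Lemma primitive_exists (h : C -> C) :
  differentiable h -> exists H, uniform_derivative H h.
Proof.
  intros Hd. assert (Hh := differentiable_Ccont h Hd).
  exists (fun w => CInt (fun s => h (s, 0%R)) 0 (Re w) +
    Ci * CInt (fun s => h (Re w, s)) 0 (Im w)).
  split; [assumption|]. intros rho eps He.
  assert (He' : (0 < eps / 2)%R) by lra.
  destruct (Ccont_uniformly h rho (eps / 2) Hh He') as [del [Hdel K]].
  exists (del / 2)%R; split; [lra|]. intros w v Hw Hv.
  destruct w as [x y], v as [a b]; cbn [Re Im fst snd Cplus].
  set (w := (x, y) : C) in *; set (v := (a, b) : C) in *.
  change (Re (w + v)) with (x + a)%R; change (Im (w + v)) with (y + b)%R.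
  change (Re w) with x; change (Im w) with y.
  assert (Ha : (Rabs a <= Cmod v)%R) by apply (re_le_Cmod v).
  assert (Hb : (Rabs b <= Cmod v)%R) by apply (Im_le_Cmod v).
  (* This rectangle lifts the horizontal piece from x to x + a from the real axis up to height y. *)
  assert (HG := Goursat_rectangle h (Rect x (x + a) 0 y) Hd); cbn in HG.
  set (J1 := CInt (fun s => h (s, y)) x (x + a)) in *.
  set (J2 := CInt (fun s => h ((x + a)%R, s)) y (y + b)) in *.
  rewrite <- (CInt_Chasles (fun s => h (s, 0%R)) 0 x (x + a)) by auto.
  rewrite <- (CInt_Chasles (fun s => h ((x + a)%R, s)) 0 y (y + b)) by auto.
  fold J2.
  set (I1 := CInt (fun s => h (s, 0%R)) 0 x) in *.
  set (I2 := CInt (fun s => h (s, 0%R)) x (x + a)) in *.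
  set (I3 := CInt (fun s => h ((x + a)%R, s)) 0 y) in *.
  set (I4 := CInt (fun s => h (x, s)) 0 y) in *.
  assert (E1 : J1 - h w * RtoC a = CInt (fun s => h (s, y) - h w) x (x + a)).
  { rewrite (CInt_minus (fun s => h (s, y)) (fun _ => h w)), CInt_const;
      [|auto|apply Ccont_const].
    fold J1. replace (x + a - x)%R with a by ring. reflexivity. }
  assert (E2 : J2 - h w * RtoC b = CInt (fun s => h ((x + a)%R, s) - h w) y (y + b)).
  { rewrite (CInt_minus (fun s => h ((x + a)%R, s)) (fun _ => h w)), CInt_const;
      [|auto|apply Ccont_const].
    fold J2. replace (y + b - y)%R with b by ring. reflexivity. }
  assert (N1 : (Cmod (J1 - h w * RtoC a) <= Rabs a * (eps / 2))%R).
  { rewrite E1. replace (Rabs a) with (Rabs (x + a - x)) by (f_equal; ring).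
    apply CInt_le; [apply Ccont_minus; [auto|apply Ccont_const]|].
    intros t Ht. apply K; [assumption|].
    eapply Rle_lt_trans; [apply Cmod_le_sum|].
    change (Rabs (t - x) + Rabs (y - y) < del)%R. rewrite Rminus_diag, Rabs_R0.
    assert (Rabs (t - x) <= Rabs a)%R; [|lra].
    revert Ht; unfold Rmin, Rmax; destruct Rle_dec; unfold Rabs;
    repeat destruct Rcase_abs; lra. }
  assert (N2 : (Cmod (J2 - h w * RtoC b) <= Rabs b * (eps / 2))%R).
  { rewrite E2. replace (Rabs b) with (Rabs (y + b - y)) by (f_equal; ring).
    apply CInt_le; [apply Ccont_minus; [auto|apply Ccont_const]|].
    intros t Ht. apply K; [assumption|].
    eapply Rle_lt_trans; [apply Cmod_le_sum|].
    change (Rabs (x + a - x) + Rabs (t - y) < del)%R.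
    replace (x + a - x)%R with a by ring.
    assert (Rabs (t - y) <= Rabs b)%R; [|lra].
    revert Ht; unfold Rmin, Rmax; destruct Rle_dec; unfold Rabs;
    repeat destruct Rcase_abs; lra. }
  assert (Ev : v = RtoC a + Ci * RtoC b).
  { unfold v, Ci; apply injective_projections; cbn; ring. }
  replace (I1 + I2 + Ci * (I3 + J2) - (I1 + Ci * I4) - h w * v)
    with ((J1 - h w * RtoC a) + Ci * (J2 - h w * RtoC b)).
  2: { rewrite Ev.
    replace I2 with (J1 - Ci * (I3 - I4) + (I2 - J1 + Ci * (I3 - I4))) by ring.
    rewrite HG. ring. }
  eapply Rle_trans; [apply Cmod_triangle|]. rewrite Cmod_mult, Cmod_Ci.
  assert (Rabs a * (eps / 2) <= Cmod v * (eps / 2))%R by (apply Rmult_le_compat_r; lra).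
  assert (Rabs b * (eps / 2) <= Cmod v * (eps / 2))%R by (apply Rmult_le_compat_r; lra).
  lra.
Qed.

(** * Cauchy's integral formula *)

Definition cis (t : R) : C := (cos t, sin t).

Lemma cis_0 : cis 0 = 1.
Proof. unfold cis; now rewrite cos_0, sin_0. Qed.

Lemma cis_plus (s t : R) : cis (s + t) = cis s * cis t.
Proof.
  unfold cis; rewrite cos_plus, sin_plus; apply injective_projections; cbn; ring.
Qed.

Lemma cis_opp_l (t : R) : cis (- t) * cis t = 1.
Proof. rewrite <- cis_plus, Rplus_opp_l; apply cis_0. Qed.

Lemma Cmod_cis (t : R) : Cmod (cis t) = 1%R.
Proof.
  unfold Cmod, cis; cbn [fst snd]. rewrite <- !Rsqr_pow2, Rplus_comm, sin2_cos2.
  apply sqrt_1.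
Qed.

Lemma cis_period (n : nat) : cis (INR n * (2 * PI)) = 1.
Proof.
  unfold cis. replace (INR n * (2 * PI))%R with (0 + 2 * INR n * PI)%R by ring.
  now rewrite cos_period, sin_period, cos_0, sin_0.
Qed.

Lemma has_tangent_cis (a t : R) :
  has_tangent (fun t => cis (a * t)) t (Ci * a * cis (a * t)).
Proof. split; cbn; auto_derive; auto; ring. Qed.

Lemma Ccont_cis (a : R) : Ccont (fun t : R => cis (a * t)).
Proof.
  intros t; destruct (has_tangent_cis a t) as [H1 H2].
  apply continuous_C_iff; split; apply (ex_derive_continuous (V := R_NormedModule));
  eexists; eassumption.
Qed.

(* This is [ζ ^ (-n)] at [ζ = cis t]; multiplying by it and averaging extracts the
   [n]-th Fourier coefficient. *)
Definition cisV (n : nat) (t : R) : C := cis (- INR n * t).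

Lemma cisV_0 (t : R) : cisV 0 t = 1.
Proof. unfold cisV; cbn. rewrite Ropp_0, Rmult_0_l; apply cis_0. Qed.

Lemma cisV_S (n : nat) (t : R) : cisV (S n) t = cisV n t * cisV 1 t.
Proof.
  unfold cisV; rewrite <- cis_plus, S_INR; f_equal; cbn; ring.
Qed.

Lemma cisV_1 (t : R) : cisV 1 t * cis t = 1.
Proof.
  rewrite <- (cis_opp_l t); unfold cisV; do 2 f_equal; cbn; ring.
Qed.

Lemma Cmod_cisV (n : nat) (t : R) : Cmod (cisV n t) = 1%R.
Proof. apply Cmod_cis. Qed.

Lemma Ccont_cisV (n : nat) : Ccont (cisV n).
Proof. apply Ccont_cis. Qed.

Lemma Ccont_cis_id : Ccont cis.
Proof.
  apply (Ccont_ext (fun t => cis (1 * t))); [intros; now rewrite Rmult_1_l|apply Ccont_cis].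
Qed.

Lemma cisV_2PI (n : nat) : cisV n (2 * PI) = 1.
Proof.
  unfold cisV. assert (H := cis_opp_l (INR n * (2 * PI))).
  rewrite cis_period in H. rewrite <- H, Cmult_1_r. f_equal; ring.
Qed.

Lemma cis_2PI : cis (2 * PI) = 1.
Proof. rewrite <- (cis_period 1); f_equal; cbn; ring. Qed.

(** For ζ = cis t one has dζ / (2πi ζ) = dt / (2π), so Cauchy integrals over the unit circle become
    averages against ζ / (ζ - q). *)
Definition avg (f : R -> C) : C := / RtoC (2 * PI) * CInt f 0 (2 * PI).

Lemma two_PI_neq_0 : RtoC (2 * PI) <> 0.
Proof. intros H; apply RtoC_inj in H; generalize PI_RGT_0; lra. Qed.

Section Average.
Implicit Types f g : R -> C.

Lemma avg_ext f g : (forall t, f t = g t) -> avg f = avg g.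
Proof. intros E; unfold avg; f_equal; now apply CInt_ext. Qed.

Lemma avg_plus f g : Ccont f -> Ccont g -> avg (fun t => f t + g t) = avg f + avg g.
Proof. intros; unfold avg; rewrite CInt_plus by assumption; ring. Qed.

Lemma avg_minus f g : Ccont f -> Ccont g -> avg (fun t => f t - g t) = avg f - avg g.
Proof. intros; unfold avg; rewrite CInt_minus by assumption; ring. Qed.

Lemma avg_scal (c : C) f : Ccont f -> avg (fun t => c * f t) = c * avg f.
Proof. intros; unfold avg; rewrite CInt_scal by assumption; ring. Qed.

Lemma avg_const (c : C) : avg (fun _ => c) = c.
Proof.
  unfold avg; rewrite CInt_const, Rminus_0_r.
  assert (H := two_PI_neq_0). field_simplify; [reflexivity|assumption].
Qed.

Lemma avg_le f (M : R) : Ccont f -> (forall t, (Cmod (f t) <= M)%R) -> (Cmod (avg f) <= M)%R.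
Proof.
  intros Hf HM; unfold avg; assert (HPI := PI_RGT_0).
  rewrite Cmod_mult, Cmod_inv by apply two_PI_neq_0.
  rewrite Cmod_R, Rabs_pos_eq by lra.
  assert (H := CInt_le f 0 (2 * PI) M Hf ltac:(auto)).
  rewrite Rminus_0_r, Rabs_pos_eq in H by lra.
  apply Rmult_le_reg_l with (2 * PI)%R; [lra|].
  rewrite <- Rmult_assoc, Rinv_r, Rmult_1_l by lra. exact H.
Qed.

Lemma avg_derivative (F f : R -> C) :
  (forall t, has_tangent F t (f t)) -> Ccont f -> F (2 * PI)%R = F 0%R -> avg f = 0.
Proof.
  intros HF Hf E; unfold avg; rewrite (CInt_FTC F f) by assumption.
  rewrite E; ring.
Qed.

End Average.

Create HintDb ccont.
#[local] Hint Resolve Ccont_const Ccont_plus Ccont_minus Ccont_mult Ccont_opp Ccont_cis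
  Ccont_cisV Ccont_cis_id Ccont_id : ccont.
#[local] Hint Extern 5 (Ccont (fun t => ?h (@?g t))) => apply (Ccont_comp h g) : ccont.

Lemma avg_cisV (n : nat) : avg (cisV (S n)) = 0.
Proof.
  assert (H0 : RtoC (- INR (S n)) <> 0).
  { apply RtoC_neq_0, Ropp_neq_0_compat, not_0_INR; lia. }
  assert (HI := Ci_neq_0).
  assert (H : avg (fun t => Ci * RtoC (- INR (S n)) * cisV (S n) t) = 0).
  { apply (avg_derivative (cisV (S n))).
    - intros t; apply has_tangent_cis.
    - auto with ccont.
    - rewrite cisV_2PI. unfold cisV. now rewrite Rmult_0_r, cis_0. }
  rewrite avg_scal in H by apply Ccont_cisV.
  replace (avg (cisV (S n))) with (/ (Ci * RtoC (- INR (S n))) *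
     (Ci * RtoC (- INR (S n)) * avg (cisV (S n)))) by (field; auto).
  rewrite H; ring.
Qed.

(* This is [ζ / (ζ - q)] at [ζ = cis t]. *)
Definition cauchy_kernel (q : C) (t : R) : C := / (1 - q * cisV 1 t).

Section Kernel.
Variable q : C.
Hypothesis Hq : (Cmod q < 1)%R.

Lemma cauchy_denominator (t : R) : (1 - Cmod q <= Cmod (1 - q * cisV 1 t))%R.
Proof.
  generalize (Cmod_triangle_inv 1 (q * cisV 1 t)).
  rewrite Cmod_mult, Cmod_cisV, Cmod_1; lra.
Qed.

Lemma cauchy_denominator_neq_0 (t : R) : 1 - q * cisV 1 t <> 0.
Proof.
  intros H; generalize (cauchy_denominator t); rewrite H, Cmod_0; lra.
Qed.

Lemma cauchy_kernel_le (t : R) : (Cmod (cauchy_kernel q t) <= / (1 - Cmod q))%R.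
Proof.
  unfold cauchy_kernel; rewrite Cmod_inv by apply cauchy_denominator_neq_0.
  apply Rinv_le_contravar; [lra|apply cauchy_denominator].
Qed.

Lemma Ccont_cauchy_kernel : Ccont (cauchy_kernel q).
Proof.
  apply Ccont_inv; [auto with ccont|apply cauchy_denominator_neq_0].
Qed.

#[local] Hint Resolve Ccont_cauchy_kernel : ccont.

(** One step of the geometric series Σ q^n ζ^(-n), with its exact remainder. *)
Lemma cauchy_kernel_step (t : R) :
  cauchy_kernel q t = 1 + q * cisV 1 t * cauchy_kernel q t.
Proof.
  unfold cauchy_kernel; generalize (cauchy_denominator_neq_0 t); intros; field; auto.
Qed.

Lemma avg_kernel_step (F : R -> C) (n : nat) : Ccont F ->
  avg (fun t => F t * cisV n t * cauchy_kernel q t) =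
  avg (fun t => F t * cisV n t) + q * avg (fun t => F t * cisV (S n) t * cauchy_kernel q t).
Proof.
  intros HF.
  rewrite <- avg_scal by auto 6 with ccont. rewrite <- avg_plus by auto 6 with ccont.
  apply avg_ext; intros t. rewrite cisV_S. rewrite (cauchy_kernel_step t) at 1. ring.
Qed.

(** If all later coefficients vanish, k steps leave only q^k times an average bounded independently
    of k. *)
Lemma avg_kernel_vanish (F : R -> C) (A : R) (n : nat) : Ccont F ->
  (forall t, (Cmod (F t) <= A)%R) ->
  (forall k, (n <= k)%nat -> avg (fun t => F t * cisV k t) = 0) ->
  avg (fun t => F t * cisV n t * cauchy_kernel q t) = 0.
Proof.
  intros HF HA H0.
  set (B n := avg (fun t => F t * cisV n t * cauchy_kernel q t)).
  set (M := (A * / (1 - Cmod q))%R).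
  assert (HA0 : (0 <= A)%R) by (eapply Rle_trans; [apply Cmod_ge_0|apply (HA 0%R)]).
  assert (HM : forall k, (Cmod (B k) <= M)%R).
  { intros k; apply avg_le; [auto 6 with ccont|]. intros t.
    rewrite !Cmod_mult, Cmod_cisV, Rmult_1_r.
    apply Rmult_le_compat; auto using Cmod_ge_0, cauchy_kernel_le. }
  assert (HB : forall k, B n = q ^ k * B (n + k)%nat).
  { induction k as [|k IH]; [rewrite Nat.add_0_r; cbn; ring|].
    rewrite IH. unfold B at 1. rewrite avg_kernel_step, H0 by (auto; lia).
    rewrite Nat.add_succ_r. fold (B (S (n + k))). cbn; ring. }
  apply Cmod_eq_0, Rle_antisym; [|apply Cmod_ge_0].
  apply le_epsilon; intros eps He.
  assert (HM0 : (0 <= M)%R) by (eapply Rle_trans; [apply Cmod_ge_0|apply (HM 0%nat)]).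
  destruct (pow_lt_1_zero (Cmod q) ltac:(rewrite Rabs_pos_eq by apply Cmod_ge_0; lra)
     (eps / (M + 1)) ltac:(apply Rdiv_lt_0_compat; lra)) as [N HN].
  specialize (HN N (Nat.le_refl _)).
  rewrite Rabs_pos_eq in HN by (apply pow_le, Cmod_ge_0).
  fold (B n); rewrite (HB N), Cmod_mult, Cmod_pow, Rplus_0_l.
  apply Rle_trans with (eps / (M + 1) * M)%R.
  - apply Rmult_le_compat; auto using Cmod_ge_0, pow_le; lra.
  - apply Rmult_le_reg_r with (M + 1)%R; [lra|].
    replace (eps / (M + 1) * M * (M + 1))%R with (eps * M)%R by (field; lra). nra.
Qed.

Lemma avg_cauchy_kernel : avg (cauchy_kernel q) = 1.
Proof.
  rewrite (avg_ext _ (fun t => 1 * cisV 0 t * cauchy_kernel q t)).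
  2: { intros t; rewrite cisV_0; ring. }
  rewrite (avg_kernel_step (fun _ => 1)) by auto with ccont.
  rewrite (avg_kernel_vanish (fun _ => 1) 1 1); auto with ccont.
  - rewrite (avg_ext _ (fun _ => 1)), avg_const; [ring|].
    intros t; rewrite cisV_0; ring.
  - intros _; rewrite Cmod_1; apply Rle_refl.
  - intros [|k] Hk; [lia|]. rewrite (avg_ext _ (cisV (S k))); [apply avg_cisV|].
    intros; ring.
Qed.

End Kernel.

(** Telescoping over n steps of length 1/n bounds the difference by eps. This takes the place of
    differentiating an average in its parameter. *)
Lemma constant_of_uniformly_flat (phi : R -> C) :
  (forall eps, (0 < eps)%R -> exists del, (0 < del)%R /\
    forall s x, (0 <= s <= 1)%R -> (0 <= x < del)%R ->
      (Cmod (phi (s + x)%R - phi s)%C <= eps * x)%R) ->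
  phi 1%R = phi 0%R.
Proof.
  intros H.
  assert (E : Cmod (phi 1%R - phi 0%R) = 0%R).
  { apply Rle_antisym; [|apply Cmod_ge_0]. apply le_epsilon; intros eps He.
    destruct (H eps He) as [del [Hdel K]].
    destruct (archimed_cor1 del Hdel) as [n [Hn Hn0]].
    assert (Hn' : (0 < INR n)%R) by (apply lt_0_INR; lia).
    assert (Hni : (0 < / INR n)%R) by now apply Rinv_0_lt_compat.
    assert (I : forall k, (k <= n)%nat ->
      (Cmod (phi (INR k / INR n)%R - phi 0%R) <= eps * (INR k / INR n))%R).
    { induction k as [|k IH]; intros Hk.
      - cbn. unfold Rdiv; rewrite Rmult_0_l.
        replace (phi 0%R - phi 0%R) with (RtoC 0) by ring. rewrite Cmod_0; lra.
      - specialize (IH ltac:(lia)).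
        assert (Hs : (0 <= INR k / INR n <= 1)%R).
        { split.
          - apply Rmult_le_pos; [apply pos_INR|lra].
          - apply Rmult_le_reg_r with (INR n); [assumption|].
            unfold Rdiv; rewrite Rmult_assoc, Rinv_l, Rmult_1_l, Rmult_1_r by lra.
            apply le_INR; lia. }
        specialize (K (INR k / INR n)%R (/ INR n)%R Hs ltac:(lra)).
        rewrite S_INR. replace ((INR k + 1) / INR n)%R with (INR k / INR n + / INR n)%R
          by (field; lra).
        replace (phi (INR k / INR n + / INR n)%R - phi 0%R) with
          ((phi (INR k / INR n + / INR n)%R - phi (INR k / INR n)%R) +
           (phi (INR k / INR n)%R - phi 0%R)) by ring.
        eapply Rle_trans; [apply Cmod_triangle|]. lra. }
    specialize (I n (Nat.le_refl n)).
    replace (INR n / INR n)%R with 1%R in I by (field; lra). lra. }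
  apply Cmod_eq_0 in E. replace (phi 1%R) with (phi 1%R - phi 0%R + phi 0%R) by ring.
  rewrite E; ring.
Qed.

Lemma has_tangent_circle (a b : C) (t : R) :
  has_tangent (fun t => a + b * cis t) t (b * (Ci * cis t)).
Proof.
  destruct a as [a1 a2], b as [b1 b2]; split; cbn; auto_derive; auto; ring.
Qed.

Lemma uniform_derivative_Ccont (H h : C -> C) : uniform_derivative H h -> Ccont H.
Proof.
  intros HH w. exact (is_cderive_continuous H w (h w) (uniform_derivative_is_cderive H h w HH)).
Qed.

(* Contract the circle to [q] along segments; the average
   [avg (H (q + s (cis t - q)) ζ / (ζ - q))] is constant in [s], because its
   derivative [avg (h (q + s (ζ - q)) ζ)] averages a derivative in [t]. *)
Lemma cauchy_formula_primitive (H h : C -> C) (q : C) : uniform_derivative H h ->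
  (Cmod q < 1)%R -> H q = avg (fun t => H (cis t) * cauchy_kernel q t).
Proof.
  intros HH Hq.
  assert (HcH := uniform_derivative_Ccont H h HH).
  assert (Hch : Ccont h) by apply HH.
  assert (HcK := Ccont_cauchy_kernel q Hq).
  set (g s t := q + RtoC s * (cis t - q)).
  assert (Hcg : forall s, Ccont (g s)) by (intros; unfold g; auto 6 with ccont).
  assert (HcHg : forall s, Ccont (fun t => H (g s t))) by (intros; now apply (Ccont_comp H)).
  assert (Hchg : forall s, Ccont (fun t => h (g s t))) by (intros; now apply (Ccont_comp h)).
  set (phi s := avg (fun t => H (g s t) * cauchy_kernel q t)).
  assert (Z : forall s, avg (fun t => h (g s t) * cis t) = 0).
  { assert (HI := Ci_neq_0).
    assert (T : forall s, RtoC s <> 0 -> forall k K, uniform_derivative K k ->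
      avg (fun t => k (g s t) * cis t) = 0).
    { intros s Hs k K HK. assert (Hk : Ccont k) by apply HK.
      assert (HKg : Ccont (fun t => k (g s t))) by now apply (Ccont_comp k).
      assert (E : avg (fun t => RtoC s * Ci * (k (g s t) * cis t)) = 0).
      { apply (avg_derivative (fun t => K (g s t))).
        - intros t. replace (RtoC s * Ci * (k (g s t) * cis t)) with
            (k (g s t) * (RtoC s * (Ci * cis t))) by ring.
          apply (has_tangent_comp K (g s)).
          + now apply uniform_derivative_is_cderive.
          + assert (G := has_tangent_circle (q - RtoC s * q) (RtoC s) t).
            revert G; unfold has_tangent; intros [G1 G2]; split;
            [revert G1|revert G2]; apply is_derive_ext; intros u; f_equal; unfold g; ring.
        - auto with ccont.
        - unfold g; now rewrite cis_2PI, cis_0. }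
      rewrite avg_scal in E by auto with ccont.
      replace (avg (fun t => k (g s t) * cis t)) with
        (/ (RtoC s * Ci) * (RtoC s * Ci * avg (fun t => k (g s t) * cis t))) by (field; auto).
      rewrite E; ring. }
    assert (Uid : uniform_derivative (fun z => z) (fun _ => 1)).
    { split; [apply Ccont_const|]. intros rho eps He; exists 1%R; split; [lra|].
      intros w v _ _. replace (w + v - w - 1 * v) with (RtoC 0) by ring.
      rewrite Cmod_0. apply Rmult_le_pos; [lra|apply Cmod_ge_0]. }
    intros s. destruct (Req_dec s 0) as [->|Hs].
    (* For s = 0 the curve is the constant [q] and its derivative in t is useless; what remains is
       avg cis = 0, the case s = 1 of [T] for the constant function 1. *)
    - assert (E := T 1%R ltac:(intros E; apply RtoC_inj in E; lra) _ _ Uid); cbn in E.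
      rewrite (avg_ext _ (fun t => h q * (1 * cis t))).
      + rewrite avg_scal by auto with ccont. rewrite E; ring.
      + intros t; replace (g 0%R t) with q by (unfold g; ring). ring.
    - apply (T s) with H; [|assumption]. intros E; apply RtoC_inj in E; auto. }
  assert (E : phi 1%R = phi 0%R).
  { apply constant_of_uniformly_flat. intros eps He.
    set (M := (/ (1 - Cmod q))%R).
    assert (HM : (0 < M)%R) by (apply Rinv_0_lt_compat; lra).
    destruct HH as [_ HH].
    (* For s in [0, 1] one has |g s t| <= |q| + |cis t - q| <= 3. The increment x (cis t - q) has
       modulus at most 2x and the kernel at most [M], whence eps / (2 M) and del / 2. *)
    destruct (HH 3%R (eps / (2 * M))%R ltac:(apply Rdiv_lt_0_compat; lra)) as [del [Hdel K]].
    exists (del / 2)%R; split; [lra|]. intros s x Hs Hx.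
    assert (HD : forall t, (Cmod (cis t - q) <= 2)%R).
    { intros t; unfold Cminus; eapply Rle_trans; [apply Cmod_triangle|].
      rewrite Cmod_cis, Cmod_opp; lra. }
    unfold phi; rewrite <- avg_minus by auto with ccont.
    rewrite (avg_ext _ (fun t =>
      (H (g (s + x)%R t) - H (g s t) - h (g s t) * (RtoC x * (cis t - q))) * cauchy_kernel q t +
      RtoC x * (h (g s t) * cis t))).
    2: { intros t.
      assert (EK : (cis t - q) * cauchy_kernel q t = cis t).
      { assert (E1 := cisV_1 t). assert (E2 := cauchy_denominator_neq_0 q Hq t).
        unfold cauchy_kernel.
        replace (cis t - q) with (cis t * (1 - q * cisV 1 t)
           + q * (cisV 1 t * cis t - 1)) by ring.
        rewrite E1. field; assumption. }
      replace (h (g s t) * cis t) with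
      (h (g s t) * ((cis t - q) * cauchy_kernel q t)) by now rewrite EK.
    ring. }
    rewrite avg_plus by auto 8 with ccont.
    rewrite (avg_scal (RtoC x)) by auto with ccont. rewrite Z, Cmult_0_r, Cplus_0_r.
    apply avg_le; [auto 8 with ccont|]. intros t.
    rewrite Cmod_mult.
    assert (Hxc : Cmod (RtoC x) = x) by (apply Cmod_RtoC_nonneg; lra).
    assert (Hsc : Cmod (RtoC s) = s) by (apply Cmod_RtoC_nonneg; lra).
    specialize (K (g s t) (RtoC x * (cis t - q))).
    replace (g s t + RtoC x * (cis t - q)) with (g (s + x)%R t) in K
      by (unfold g; rewrite RtoC_plus; ring).
    rewrite Cmod_mult, Hxc in K. specialize (HD t).
    assert (Hg : (Cmod (g s t) <= 3)%R).
    { unfold g; eapply Rle_trans; [apply Cmod_triangle|]. rewrite Cmod_mult, Hsc. nra. }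
    specialize (K Hg ltac:(nra)).
    apply Rle_trans with (eps / (2 * M) * (x * 2) * M)%R; [|right; field; lra].
    apply Rmult_le_compat; auto using Cmod_ge_0, cauchy_kernel_le.
    eapply Rle_trans; [exact K|]. apply Rmult_le_compat_l; [|nra].
    apply Rlt_le, Rdiv_lt_0_compat; lra. }
  unfold phi in E.
  rewrite (avg_ext (fun t => H (g 0%R t) * _) (fun t => H q * cauchy_kernel q t)) in E.
  2: { intros t; replace (g 0%R t) with q by (unfold g; ring). reflexivity. }
  rewrite avg_scal, avg_cauchy_kernel, Cmult_1_r in E by auto.
  rewrite <- E; apply avg_ext; intros t.
  replace (g 1%R t) with (cis t) by (unfold g; ring). reflexivity.
Qed.

(** * Entire functions of one variable *)

Lemma Ccont_bounded_on_disk (h : C -> C) (rho : R) : Ccont h ->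
  exists M, (0 < M)%R /\ forall z, (Cmod z <= rho)%R -> (Cmod (h z) <= M)%R.
Proof.
  intros Hh. destruct (Ccont_bounded (box rho) h (gauge_compact_box rho) Hh) as [M [HM K]].
  exists M; split; [assumption|]. intros z Hz; apply K, Cmod_box, Hz.
Qed.

Lemma is_cderive_unique (h : C -> C) (w l m : C) :
  is_cderive h w l -> is_cderive h w m -> l = m.
Proof.
  intros Hl Hm.
  assert (E : Cmod (l - m) = 0%R).
  { apply Rle_antisym; [|apply Cmod_ge_0]. apply le_epsilon; intros eps He.
    destruct (Hl (eps / 2)%R ltac:(lra)) as [d1 [Hd1 K1]].
    destruct (Hm (eps / 2)%R ltac:(lra)) as [d2 [Hd2 K2]].
    set (x := (Rmin d1 d2 / 2)%R).
    assert (Hx : (0 < x)%R /\ (x < d1)%R /\ (x < d2)%R).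
    { unfold x; generalize (Rmin_l d1 d2) (Rmin_r d1 d2) (Rmin_glb_lt d1 d2 0 Hd1 Hd2); lra. }
    assert (Hc : Cmod (RtoC x) = x) by (apply Cmod_RtoC_nonneg; lra).
    specialize (K1 (RtoC x)); specialize (K2 (RtoC x)); rewrite Hc in *.
    specialize (K1 ltac:(lra)); specialize (K2 ltac:(lra)).
    assert (N : (Cmod ((l - m) * RtoC x) <= eps * x)%R).
    { replace ((l - m) * RtoC x) with
        ((h (w + RtoC x) - h w - m * RtoC x) + - (h (w + RtoC x) - h w - l * RtoC x)) by ring.
      eapply Rle_trans; [apply Cmod_triangle|]. rewrite Cmod_opp. lra. }
    rewrite Cmod_mult, Hc in N. rewrite Rplus_0_l.
    apply Rmult_le_reg_r with x; lra. }
  apply Cmod_eq_0 in E. replace l with (l - m + m) by ring. rewrite E; ring.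
Qed.

Lemma is_cderive_affine (h : C -> C) (a b w l : C) :
  is_cderive h (a + b * w) l -> is_cderive (fun z => h (a + b * z)) w (b * l).
Proof.
  intros H eps He.
  set (A := (Cmod b + 1)%R).
  assert (HA : (0 < A)%R) by (unfold A; generalize (Cmod_ge_0 b); lra).
  destruct (H (eps / A)%R ltac:(now apply Rdiv_lt_0_compat)) as [d [Hd K]].
  exists (d / A)%R; split; [now apply Rdiv_lt_0_compat|]. intros v Hv.
  assert (Hbv : (Cmod (b * v) <= A * Cmod v)%R).
  { rewrite Cmod_mult; apply Rmult_le_compat_r; [apply Cmod_ge_0|unfold A; lra]. }
  specialize (K (b * v)).
  replace (a + b * w + b * v) with (a + b * (w + v)) in K by ring.
  replace (b * l * v) with (l * (b * v)) by ring.
  assert (HvA : (A * Cmod v < d)%R).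
  { replace d with (A * (d / A))%R by (field; lra). now apply Rmult_lt_compat_l. }
  eapply Rle_trans; [apply K; lra|].
  apply Rle_trans with (eps / A * (A * Cmod v))%R; [|right; field; lra].
  apply Rmult_le_compat_l; [|assumption]. apply Rlt_le, Rdiv_lt_0_compat; lra.
Qed.

Lemma differentiable_affine (h : C -> C) (a b : C) :
  differentiable h -> differentiable (fun z => h (a + b * z)).
Proof.
  intros H w; destruct (H (a + b * w)) as [l Hl].
  exists (b * l); now apply is_cderive_affine.
Qed.

Lemma differentiable_shift (h : C -> C) (a : C) :
  differentiable h -> differentiable (fun z => h (a + z)).
Proof.
  intros H; generalize (differentiable_affine h a 1 H); apply differentiable_ext.
  intros w; now rewrite Cmult_1_l.
Qed.

Lemma is_cderive_of_quadratic (h : C -> C) (w l : C) (A r : R) :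
  (0 < r)%R -> (forall v, (Cmod v <= r)%R ->
     (Cmod (h (w + v) - h w - l * v)%C <= A * Cmod v ^ 2)%R) -> is_cderive h w l.
Proof.
  intros Hr K eps He.
  set (B := (Rabs A + 1)%R).
  assert (HB : (0 < B)%R) by (unfold B; generalize (Rabs_pos A); lra).
  exists (Rmin r (eps / B)); split.
  { apply Rmin_glb_lt; [assumption|now apply Rdiv_lt_0_compat]. }
  intros v Hv. assert (H1 := Rmin_l r (eps / B)); assert (H2 := Rmin_r r (eps / B)).
  eapply Rle_trans; [apply K; lra|].
  assert (H0 := Cmod_ge_0 v).
  assert (HBv : (B * Cmod v <= eps)%R).
  { replace eps with (B * (eps / B))%R by (field; lra). apply Rmult_le_compat_l; lra. }
  apply Rle_trans with (B * Cmod v * Cmod v)%R; [|nra].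
  unfold B; generalize (Rle_abs A); nra.
Qed.

(* Total, but it is the complex derivative only when [h] is differentiable. *)
Definition derivative (h : C -> C) (w : C) : C := avg (fun t => h (w + cis t) * cisV 1 t).

(** Two kernel steps leave v^2 times an average whose kernel is at most 2 for |v| <= 1/2. Cauchy's
    formula is a hypothesis because the lemma is applied first to primitives, before the formula is
    known for all differentiable functions. The constant depends only on [A]. *)
Lemma taylor2 (h : C -> C) (A : R) :
  Ccont h ->
  (forall q, (Cmod q < 1)%R -> h q = avg (fun t => h (cis t) * cauchy_kernel q t)) ->
  (forall t, (Cmod (h (cis t)) <= A)%R) ->
  forall v, (Cmod v <= 1 / 2)%R ->
    (Cmod (h v - h 0 - derivative h 0 * v)%C <= 2 * A * Cmod v ^ 2)%R.
Proof.
  intros Hh HC HA.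
  assert (Hc : Ccont (fun t => h (cis t))) by auto with ccont.
  assert (E : forall q, (Cmod q < 1)%R -> h q = avg (fun t => h (cis t) * cisV 0 t) +
     q * (derivative h 0 + q * avg (fun t => h (cis t) * cisV 2 t * cauchy_kernel q t))).
  { intros q Hq. rewrite (HC q Hq).
    rewrite (avg_ext _ (fun t => h (cis t) * cisV 0 t * cauchy_kernel q t)).
    2: { intros t; rewrite cisV_0; ring. }
    rewrite (avg_kernel_step q Hq (fun t => h (cis t))) by assumption.
    rewrite (avg_kernel_step q Hq (fun t => h (cis t)) 1) by assumption.
    do 3 f_equal. apply avg_ext; intros t; now rewrite Cplus_0_l. }
  intros v Hv.
  assert (E0 := E 0 ltac:(rewrite Cmod_0; lra)). rewrite Cmult_0_l, Cplus_0_r in E0.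
  rewrite (E v) by lra. rewrite <- E0.
  match goal with |- context [avg ?f] => set (B := avg f) end.
  replace (h 0 + v * (derivative h 0 + v * B) - h 0 - derivative h 0 * v)
    with (B * v ^ 2) by (cbn; ring).
  rewrite Cmod_mult, Cmod_pow. apply Rmult_le_compat_r; [apply pow2_ge_0|].
  assert (HK := Ccont_cauchy_kernel v ltac:(lra)).
  apply avg_le; [auto 6 with ccont|]. intros t.
  rewrite !Cmod_mult, Cmod_cisV, Rmult_1_r, Rmult_comm.
  apply Rmult_le_compat; auto using Cmod_ge_0.
  eapply Rle_trans; [apply cauchy_kernel_le; lra|].
  replace 2%R with (/ (1 / 2))%R by lra. apply Rinv_le_contravar; lra.
Qed.

Lemma uniform_derivative_shift (H h : C -> C) (a : C) :
  uniform_derivative H h -> uniform_derivative (fun z => H (a + z)) (fun z => h (a + z)).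
Proof.
  intros [Hh HH]; split; [auto with ccont|]. intros rho eps He.
  destruct (HH (Cmod a + rho)%R eps He) as [d [Hd K]].
  exists d; split; [assumption|]. intros w v Hw Hv.
  replace (a + (w + v)) with (a + w + v) by ring. apply K; [|assumption].
  eapply Rle_trans; [apply Cmod_triangle|]. lra.
Qed.

Lemma uniform_derivative_mean_value (H h : C -> C) (w : C) :
  uniform_derivative H h -> h w = derivative H w.
Proof.
  intros HH. assert (HcH := uniform_derivative_Ccont H h HH).
  destruct (Ccont_bounded_on_disk H (Cmod w + 1) HcH) as [A [_ HA]].
  apply (is_cderive_unique H w); [now apply uniform_derivative_is_cderive|].
  apply is_cderive_of_quadratic with (A := (2 * A)%R) (r := (1 / 2)%R); [lra|].
  intros v Hv.
  assert (T := taylor2 (fun z => H (w + z)) A).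
  cbv beta in T. rewrite Cplus_0_r in T.
  replace (derivative H w) with (derivative (fun z => H (w + z)) 0).
  2: { apply avg_ext; intros t. now rewrite Cplus_0_l. }
  apply T; auto with ccont.
  - intros q Hq. apply (cauchy_formula_primitive (fun z => H (w + z)) (fun z => h (w + z)));
    [now apply uniform_derivative_shift|assumption].
  - intros t. apply HA. eapply Rle_trans; [apply Cmod_triangle|].
    rewrite Cmod_cis; lra.
Qed.

(** Regularity is gained here. For a primitive [H], h(w) is the average of H(w + ζ) ζ^(-1);
    averaging the uniform expansion of [H] at the points w + ζ gives that of [h], with the average
    of h(w + ζ) ζ^(-1) as derivative. *)
Lemma differentiable_uniform (h : C -> C) :
  differentiable h -> uniform_derivative h (derivative h).
Proof.
  intros Hd. assert (Hh := differentiable_Ccont h Hd).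
  destruct (primitive_exists h Hd) as [H HH].
  assert (HcH := uniform_derivative_Ccont H h HH).
  split.
  - intros w. apply continuous_Cmod_iff; intros eps He.
    destruct (Ccont_uniformly h (Cmod w + 1) (eps / 2) Hh ltac:(lra)) as [d [Hdp K]].
    exists (mkposreal (d / 2) ltac:(lra)). intros z [Hz1 Hz2].
    change (Rabs (Re (z - w)) < d / 2)%R in Hz1.
    change (Rabs (Im (z - w)) < d / 2)%R in Hz2.
    assert (Hz := Cmod_le_sum (z - w)).
    unfold derivative; rewrite <- avg_minus by auto 6 with ccont.
    apply Rle_lt_trans with (eps / 2)%R; [|lra].
    apply avg_le; [auto 8 with ccont|]. intros t.
    replace (h (z + cis t) * cisV 1 t - h (w + cis t) * cisV 1 t)
      with ((h (z + cis t) - h (w + cis t)) * cisV 1 t) by ring.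
    rewrite Cmod_mult, Cmod_cisV, Rmult_1_r. apply K.
    + eapply Rle_trans; [apply Cmod_triangle|]. rewrite Cmod_cis; lra.
    + assert (E : forall x y u : C, x + u - (y + u) = x - y) by (intros; ring).
      rewrite E. lra.
  - intros rho eps He. destruct HH as [HH0 HH].
    destruct (HH (rho + 1)%R eps He) as [d [Hdp K]].
    exists d; split; [assumption|]. intros w v Hw Hv.
    assert (HHU : uniform_derivative H h) by now split.
    rewrite (uniform_derivative_mean_value H h (w + v) HHU), (uniform_derivative_mean_value H h w HHU).
    unfold derivative. rewrite (Cmult_comm _ v), <- avg_scal by auto 6 with ccont.
    rewrite <- !avg_minus by auto 8 with ccont.
    apply avg_le; [auto 12 with ccont|]. intros t.
    replace (H (w + v + cis t) * cisV 1 t - H (w + cis t) * cisV 1 t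
        - v * (h (w + cis t) * cisV 1 t))
      with ((H (w + cis t + v) - H (w + cis t) - h (w + cis t) * v) * cisV 1 t).
    2: { replace (w + v + cis t) with (w + cis t + v) by ring. ring. }
    rewrite Cmod_mult, Cmod_cisV, Rmult_1_r. apply K; [|assumption].
    eapply Rle_trans; [apply Cmod_triangle|]. rewrite Cmod_cis; lra.
Qed.

Lemma cauchy_formula (h : C -> C) (q : C) : differentiable h -> (Cmod q < 1)%R ->
  h q = avg (fun t => h (cis t) * cauchy_kernel q t).
Proof.
  intros Hd; apply cauchy_formula_primitive with (derivative h).
  now apply differentiable_uniform.
Qed.

Lemma is_cderive_derivative (h : C -> C) (w : C) :
  differentiable h -> is_cderive h w (derivative h w).
Proof. intros H; now apply uniform_derivative_is_cderive, differentiable_uniform. Qed.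

Lemma differentiable_taylor2 (h : C -> C) (w v : C) (A : R) : differentiable h ->
  (forall t, (Cmod (h (w + cis t)%C) <= A)%R) -> (Cmod v <= 1 / 2)%R ->
  (Cmod (h (w + v) - h w - derivative h w * v)%C <= 2 * A * Cmod v ^ 2)%R.
Proof.
  intros Hd HA.
  assert (Hd' := differentiable_shift h w Hd).
  assert (T := taylor2 (fun z => h (w + z)) A). cbv beta in T. rewrite Cplus_0_r in T.
  replace (derivative h w) with (derivative (fun z => h (w + z)) 0).
  2: { apply avg_ext; intros t. now rewrite Cplus_0_l. }
  apply T; [now apply differentiable_Ccont|now intros; apply (cauchy_formula (fun z => h (w + z)))|assumption].
Qed.

(** The second-order remainder is bounded uniformly in the parameter, so the expansions may be
    averaged. That the derivative is continuous in the parameter is not assumed but follows, since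
    it is a uniform limit of difference quotients. *)
Lemma differentiable_avg (G : C -> R -> C) :
  (forall s, differentiable (fun w => G w s)) -> (forall w, Ccont (G w)) ->
  (forall rho, exists A, forall w s, (Cmod w <= rho)%R -> (Cmod (G w s) <= A)%R) ->
  differentiable (fun w => avg (G w)).
Proof.
  intros Hd Hc Hb w.
  destruct (Hb (Cmod w + 1)%R) as [A HA].
  assert (HA0 : (0 <= A)%R).
  { eapply Rle_trans; [apply Cmod_ge_0|apply (HA w 0%R); lra]. }
  pose (k s := derivative (fun z => G z s) w).
  assert (T : forall s v, (Cmod v <= 1 / 2)%R ->
    (Cmod (G (w + v) s - G w s - k s * v)%C <= 2 * A * Cmod v ^ 2)%R).
  { intros s v Hv. apply (differentiable_taylor2 (fun z => G z s)); auto.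
    intros t; apply HA. eapply Rle_trans; [apply Cmod_triangle|]. rewrite Cmod_cis; lra. }
  assert (Hk : Ccont k).
  { intros s0. apply continuous_Cmod_iff; intros eps He.
    (* The two remainders, 2 A x^2 each, amount to at most (eps / 2) x; the difference quotients
       contribute another (eps / 4) x. *)
    set (x := Rmin (1 / 2) (eps / (8 * (A + 1)))).
    assert (Hx0 : (0 < x)%R).
    { apply Rmin_glb_lt; [lra|]. apply Rdiv_lt_0_compat; lra. }
    assert (Hx1 : (x <= 1 / 2)%R) by apply Rmin_l.
    assert (HxA : (8 * A * x <= eps)%R).
    { assert (x <= eps / (8 * (A + 1)))%R by apply Rmin_r.
      apply Rle_trans with (8 * (A + 1) * x)%R; [nra|].
      replace eps with (8 * (A + 1) * (eps / (8 * (A + 1))))%R by (field; lra).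
      apply Rmult_le_compat_l; lra. }
    assert (Hcx : Cmod (RtoC x) = x) by (apply Cmod_RtoC_nonneg; lra).
    assert (HD : Ccont (fun s => G (w + RtoC x) s - G w s)) by (apply Ccont_minus; apply Hc).
    specialize (HD s0). apply continuous_Cmod_iff with (eps := (eps / 4 * x)%R) in HD; [|nra].
    revert HD; apply filter_imp; intros s Hs.
    assert (T1 := T s (RtoC x) ltac:(lra)). assert (T2 := T s0 (RtoC x) ltac:(lra)).
    rewrite Hcx in T1, T2.
    apply Rmult_lt_reg_r with x; [assumption|].
    rewrite <- Hcx at 1. rewrite <- Cmod_mult.
    set (a := G (w + RtoC x) s - G w s) in *. set (b := G (w + RtoC x) s0 - G w s0) in *.
    replace ((k s - k s0) * RtoC x) with
      ((a - b) + (- (a - k s * RtoC x) + (b - k s0 * RtoC x))) by ring.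
    eapply Rle_lt_trans; [apply Cmod_triangle|].
    eapply Rle_lt_trans; [apply Rplus_le_compat_l, Cmod_triangle|].
    rewrite Cmod_opp. nra. }
  exists (avg k).
  apply is_cderive_of_quadratic with (A := (2 * A)%R) (r := (1 / 2)%R); [lra|]. intros v Hv.
  rewrite (Cmult_comm _ v), <- avg_scal by assumption.
  rewrite <- !avg_minus by auto with ccont.
  apply avg_le; [auto 8 with ccont|]. intros s.
  rewrite (Cmult_comm v). now apply T.
Qed.

Lemma differentiable_scal (h : C -> C) (c : C) :
  differentiable h -> differentiable (fun z => h z * c).
Proof.
  intros H w; destruct (H w) as [l Hl]; exists (l * c). intros eps He.
  set (A := (Cmod c + 1)%R).
  assert (HA : (0 < A)%R) by (unfold A; generalize (Cmod_ge_0 c); lra).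
  destruct (Hl (eps / A)%R ltac:(now apply Rdiv_lt_0_compat)) as [d [Hd K]].
  exists d; split; [assumption|]. intros v Hv. specialize (K v Hv).
  replace (h (w + v) * c - h w * c - l * c * v) with ((h (w + v) - h w - l * v) * c) by ring.
  rewrite Cmod_mult.
  apply Rle_trans with (eps / A * Cmod v * A)%R; [|right; field; lra].
  apply Rmult_le_compat; auto using Cmod_ge_0. unfold A; lra.
Qed.

Lemma differentiable_minus (h k : C -> C) :
  differentiable h -> differentiable k -> differentiable (fun z => h z - k z).
Proof.
  intros H K w; destruct (H w) as [l Hl], (K w) as [m Hm]; exists (l - m). intros eps He.
  destruct (Hl (eps / 2)%R ltac:(lra)) as [d1 [Hd1 K1]].
  destruct (Hm (eps / 2)%R ltac:(lra)) as [d2 [Hd2 K2]].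
  exists (Rmin d1 d2); split; [now apply Rmin_glb_lt|]. intros v Hv.
  specialize (K1 v (Rlt_le_trans _ _ _ Hv (Rmin_l _ _))).
  specialize (K2 v (Rlt_le_trans _ _ _ Hv (Rmin_r _ _))).
  replace (h (w + v) - k (w + v) - (h w - k w) - (l - m) * v)
    with ((h (w + v) - h w - l * v) + - (k (w + v) - k w - m * v)) by ring.
  eapply Rle_trans; [apply Cmod_triangle|]. rewrite Cmod_opp. lra.
Qed.

Lemma differentiable_derivative (h : C -> C) :
  differentiable h -> differentiable (derivative h).
Proof.
  intros Hd. assert (Hh := differentiable_Ccont h Hd).
  apply (differentiable_avg (fun w t => h (w + cis t) * cisV 1 t)).
  - intros t. apply (differentiable_scal (fun w => h (w + cis t))).
    generalize (differentiable_shift h (cis t) Hd); apply differentiable_ext.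
    intros w; now rewrite Cplus_comm.
  - intros w; auto 6 with ccont.
  - intros rho. destruct (Ccont_bounded_on_disk h (rho + 1) Hh) as [A [_ HA]].
    exists A; intros w t Hw. rewrite Cmod_mult, Cmod_cisV, Rmult_1_r. apply HA.
    eapply Rle_trans; [apply Cmod_triangle|]. rewrite Cmod_cis; lra.
Qed.

(** * Cauchy estimates and a Liouville theorem for periodic functions *)

Lemma cauchy_estimate (h : C -> C) (w : C) (r A : R) : differentiable h -> (0 < r)%R ->
  (forall z, (Cmod z <= Cmod w + r)%R -> (Cmod (h z) <= A)%R) ->
  (Cmod (derivative h w) <= A / r)%R.
Proof.
  intros Hd Hr HA. assert (Hh := differentiable_Ccont h Hd).
  (* [derivative] averages over the unit circle only; the circle of radius [r] is reached by
     rescaling and uniqueness of the derivative. *)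
  assert (E : RtoC r * derivative h w = derivative (fun z => h (w + RtoC r * z)) 0).
  { apply (is_cderive_unique (fun z => h (w + RtoC r * z)) 0).
    - apply is_cderive_affine. rewrite Cmult_0_r, Cplus_0_r. now apply is_cderive_derivative.
    - apply is_cderive_derivative. now apply differentiable_affine. }
  assert (Hcr : Cmod (RtoC r) = r) by (apply Cmod_RtoC_nonneg; lra).
  apply Rmult_le_reg_l with r; [assumption|].
  replace (r * (A / r))%R with A by (field; lra).
  rewrite <- Hcr at 1. rewrite <- Cmod_mult, E. unfold derivative.
  apply avg_le; [auto 10 with ccont|]. intros t.
  rewrite Cmod_mult, Cmod_cisV, Rmult_1_r. apply HA.
  eapply Rle_trans; [apply Cmod_triangle|].
  rewrite Cplus_0_l, Cmod_mult, Hcr, Cmod_cis. lra.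
Qed.

Lemma affine_of_constant_derivative (h : C -> C) (a : C) :
  (forall w, is_cderive h w a) -> forall w, h w = h 0 + a * w.
Proof.
  intros H w.
  assert (E := CInt_FTC (fun t => h (0 + w * RtoC t)) (fun _ => a * w) 0 1).
  cbv beta in E. rewrite CInt_const in E.
  replace (0 + w * RtoC 1) with w in E by ring.
  replace (0 + w * RtoC 0) with (RtoC 0) in E by ring.
  rewrite Rminus_0_r, Cmult_1_r in E. rewrite E; [ring| |apply Ccont_const].
  intros t. apply (has_tangent_comp h); [apply H|].
  destruct w as [x y]; split; cbn; auto_derive; auto; ring.
Qed.

(** Induction on the degree: the derivative keeps the period and loses one degree, so it is constant
    and [h] is affine; the nonzero period then kills the slope. *)
Lemma periodic_polynomial_growth_constant (d : nat) (h : C -> C) (c : C) (A : R) :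
  differentiable h -> (forall w, (Cmod (h w) <= A * (1 + Cmod w) ^ d)%R) ->
  c <> 0 -> (forall w, h (w + c) = h w) -> forall w, h w = h 0.
Proof.
  intros Hd HA Hc; revert h A Hd HA.
  assert (Hconst : forall h, differentiable h -> (forall w, h (w + c) = h w) ->
    (exists a, forall w, derivative h w = a) -> forall w, h w = h 0).
  { intros h Hd Hp [a Ha].
    assert (E : forall w, h w = h 0 + a * w).
    { apply affine_of_constant_derivative. intros w; rewrite <- (Ha w).
      now apply is_cderive_derivative. }
    assert (E0 := Hp 0). rewrite Cplus_0_l, E in E0.
    assert (Ha0 : a = 0).
    { replace a with ((h 0 + a * c - h 0) / c) by (field; assumption).
      rewrite E0; field; assumption. }
    intros w; rewrite E, Ha0; ring. }
  induction d as [|d IH]; intros h A Hd HA Hp; apply Hconst; trivial;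
  assert (HA0 : (0 <= A)%R) by
    (assert (HA' := HA 0); rewrite Cmod_0, Rplus_0_r, pow1 in HA';
     generalize (Cmod_ge_0 (h 0)); lra).
  - exists 0; intros w. apply Cmod_eq_0, Rle_antisym; [|apply Cmod_ge_0].
    apply le_epsilon; intros eps He. rewrite Rplus_0_l.
    (* Liouville: this radius makes the Cauchy estimate smaller than eps. *)
    assert (Hr : (0 < (A + 1) / eps)%R) by (apply Rdiv_lt_0_compat; lra).
    eapply Rle_trans; [apply (cauchy_estimate h w ((A + 1) / eps) A Hd Hr)|].
    + intros z _. specialize (HA z). cbn in HA. lra.
    + apply Rmult_le_reg_r with (A + 1)%R; [lra|].
      replace (A / ((A + 1) / eps) * (A + 1))%R with (A * eps)%R by (field; lra). nra.
  - exists (derivative h 0).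
    apply (IH (derivative h) (A * 2 ^ S d)%R).
    + now apply differentiable_derivative.
    (* With this radius 1 + |z| <= 2 r on the disk of the Cauchy estimate, which produces the
       constant A 2^(d+1). *)
    + intros w. set (r := (1 + Cmod w)%R).
      assert (Hr : (0 < r)%R) by (unfold r; generalize (Cmod_ge_0 w); lra).
      replace (A * 2 ^ S d * r ^ d)%R with (A * (2 * r) ^ S d / r)%R
        by (rewrite Rpow_mult_distr; cbn; field; lra).
      apply cauchy_estimate; [assumption..|]. intros z Hz.
      eapply Rle_trans; [apply HA|]. apply Rmult_le_compat_l; [assumption|].
      apply pow_incr. generalize (Cmod_ge_0 z). unfold r in *; lra.
    + intros w. unfold derivative; apply avg_ext; intros t.
      rewrite <- (Hp (w + cis t)). do 2 f_equal. ring.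
Qed.

(** * Taylor coefficients at the origin *)

Lemma has_tangent_mult (F G : R -> C) (t : R) (l m : C) :
  has_tangent F t l -> has_tangent G t m ->
  has_tangent (fun s => F s * G s) t (l * G t + F t * m).
Proof.
  unfold has_tangent; intros [F1 F2] [G1 G2].
  assert (P : forall u v x y, is_derive u t x -> is_derive v t y ->
    is_derive (fun s => u s * v s)%R t (x * v t + u t * y)%R).
  { intros; now apply (is_derive_mult (K := R_AbsRing)); [..|intros; apply Rmult_comm]. }
  assert (E1 := is_derive_minus _ _ _ _ _ (P _ _ _ _ F1 G1) (P _ _ _ _ F2 G2)).
  assert (E2 := is_derive_plus _ _ _ _ _ (P _ _ _ _ F1 G2) (P _ _ _ _ F2 G1)).
  split; [revert E1|revert E2];
  match goal with |- is_derive _ _ ?a -> is_derive _ _ ?b => replace b with a; [trivial|] end;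
  destruct l, m, (F t), (G t); cbn; unfold minus, plus, opp; cbn; ring.
Qed.

(** For entire [h] this is r^N times the N-th Taylor coefficient at 0; the power of [r] is kept
    because it will express homogeneity. *)
Definition taylor_coef (N : nat) (h : C -> C) (r : R) : C :=
  avg (fun t => h (RtoC r * cis t) * cisV N t).

(* Integration by parts; this makes the dependence of Taylor coefficients on the
   radius an induction on [N]. *)
Lemma taylor_coef_derivative (N : nat) (h : C -> C) (r : R) : differentiable h ->
  RtoC (INR (S N)) * taylor_coef (S N) h r = RtoC r * taylor_coef N (derivative h) r.
Proof.
  intros Hd. assert (Hh := differentiable_Ccont h Hd).
  assert (Hh' := differentiable_Ccont _ (differentiable_derivative h Hd)).
  assert (Hc : Ccont (fun t => h (RtoC r * cis t))) by (apply (Ccont_comp h); auto with ccont).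
  assert (Hc' : Ccont (fun t => derivative h (RtoC r * cis t)))
    by (apply (Ccont_comp (derivative h)); auto with ccont).
  assert (HI := Ci_neq_0).
  assert (E : avg (fun t => Ci * (RtoC r * (derivative h (RtoC r * cis t) * cisV N t)
     - RtoC (INR (S N)) * (h (RtoC r * cis t) * cisV (S N) t))) = 0).
  { apply (avg_derivative (fun t => h (RtoC r * cis t) * cisV (S N) t)).
    - intros t.
      assert (T1 : has_tangent (fun t => h (RtoC r * cis t)) t
        (derivative h (RtoC r * cis t) * (RtoC r * (Ci * cis t)))).
      { apply (has_tangent_comp h); [now apply is_cderive_derivative|].
        destruct (has_tangent_circle 0 (RtoC r) t) as [G1 G2]; split;
        [revert G1|revert G2]; apply is_derive_ext; intros u; now rewrite Cplus_0_l. }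
      assert (T2 := has_tangent_cis (- INR (S N)) t).
      assert (T3 := has_tangent_mult _ _ _ _ _ T1 T2).
      match goal with |- has_tangent _ _ ?l =>
        match type of T3 with has_tangent _ _ ?m => replace l with m; [exact T3|] end end.
      rewrite cisV_S. rewrite RtoC_opp. fold (cisV (S N) t). rewrite cisV_S.
      replace (cisV N t) with (cisV N t * (cisV 1 t * cis t)) at 3 by (rewrite cisV_1; ring).
      ring.
    - auto 10 with ccont.
    - rewrite cisV_2PI, cis_2PI, cis_0. unfold cisV. now rewrite Rmult_0_r, cis_0. }
  rewrite avg_scal in E by auto 10 with ccont.
  rewrite avg_minus in E by auto 10 with ccont.
  rewrite !avg_scal in E by auto 10 with ccont.
  fold (taylor_coef N (derivative h) r) in E. fold (taylor_coef (S N) h r) in E.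
  set (a := RtoC (INR (S N)) * taylor_coef (S N) h r) in *.
  set (b := RtoC r * taylor_coef N (derivative h) r) in *.
  replace a with (b - / Ci * (Ci * (b - a))) by (field; assumption).
  rewrite E; ring.
Qed.

Lemma taylor_coef_scale (N : nat) (h : C -> C) (r : R) : differentiable h ->
  taylor_coef N h r = RtoC (r ^ N) * taylor_coef N h 1.
Proof.
  revert h; induction N as [|N IH]; intros h Hd.
  (* Mean value property: Cauchy's formula at the centre, where the kernel is 1. *)
  - assert (E : forall s, taylor_coef 0 h s = h 0).
    { intros s. assert (H := cauchy_formula (fun z => h (0 + RtoC s * z)) 0
        (differentiable_affine h 0 (RtoC s) Hd) ltac:(rewrite Cmod_0; lra)).
      cbv beta in H. rewrite Cmult_0_r, Cplus_0_l in H. rewrite H.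
      apply avg_ext; intros t. rewrite cisV_0, Cplus_0_l. unfold cauchy_kernel.
      field. }
    rewrite !E; cbn; ring.
  - assert (H0 : RtoC (INR (S N)) <> 0) by (apply RtoC_neq_0, not_0_INR; lia).
    assert (E1 := taylor_coef_derivative N h r Hd).
    assert (E2 := taylor_coef_derivative N h 1 Hd).
    rewrite (IH _ (differentiable_derivative h Hd)) in E1.
    rewrite Cmult_1_l in E2. rewrite <- E2 in E1.
    replace (taylor_coef (S N) h r) with
      (/ RtoC (INR (S N)) * (RtoC (INR (S N)) * taylor_coef (S N) h r)) by (field; assumption).
    rewrite E1. cbn [pow]. rewrite RtoC_mult. field; assumption.
Qed.

(** Every term of the expanded Cauchy kernel averages to 0 and [avg_kernel_vanish] disposes of the
    remainder. Only the open unit disk is reached. *)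
Lemma taylor_coef_vanish (h : C -> C) (q : C) : differentiable h ->
  (forall N, taylor_coef N h 1 = 0) -> (Cmod q < 1)%R -> h q = 0.
Proof.
  intros Hd H0 Hq. assert (Hh := differentiable_Ccont h Hd).
  destruct (Ccont_bounded_on_disk h 1 Hh) as [A [_ HA]].
  rewrite (cauchy_formula h q Hd Hq).
  rewrite <- (avg_kernel_vanish q Hq (fun t => h (cis t)) A 0).
  - apply avg_ext; intros t; rewrite cisV_0; ring.
  - auto with ccont.
  - intros t; apply HA; rewrite Cmod_cis; apply Rle_refl.
  - intros k _; rewrite <- (H0 k); apply avg_ext; intros t; now rewrite Cmult_1_l.
Qed.

(** * The lift of a holomorphic function on X *)

Lemma differentiable_entire (F : C -> C) : differentiable F -> entire F.
Proof.
  intros HF w; destruct (HF w) as [l Hl]; exists l; split.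
  - apply is_linear_scal_l.
  - intros x Hx eps.
    assert (E : w = x)
      by exact (is_filter_lim_locally_unique (V := AbsRing_NormedModule C_AbsRing) w x Hx).
    subst x. destruct (Hl eps (cond_pos eps)) as [d [Hd K]].
    exists (mkposreal d Hd). intros y Hy.
    change (Cmod (y - w) < d)%R in Hy. specialize (K (y - w) Hy).
    assert (E : forall a b : C, a + (b - a) = b) by (intros; ring).
    rewrite E in K.
    change (Cmod (F y - F w - (y - w) * l)%C <= eps * Cmod (y - w))%R.
    now rewrite (Cmult_comm _ l).
Qed.

(** The differential [l] is complex linear, so l(v d) = v l(d) and the restriction to the line has
    derivative [l d]. Apart from continuity, this is all that is used of holomorphy in three
    variables. *)
Lemma filterdiff_differentiable_line (g : C3 -> C) (p d : C3) :
  (forall q, ex_filterdiff (V := C_NormedModule) g (locally q)) ->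
  differentiable (fun w : C => g (plus p (scal w d))).
Proof.
  intros Hg w. set (q := plus p (scal w d) : C3).
  destruct (Hg q) as [l [Hl Hdom]]. exists (l d). intros eps He.
  specialize (Hdom q (fun P HP => HP)).
  set (A := (norm d + 1)%R).
  assert (HA : (0 < A)%R) by (unfold A; generalize (norm_ge_0 d); lra).
  assert (He' : (0 < eps / A)%R) by now apply Rdiv_lt_0_compat.
  specialize (Hdom (mkposreal _ He')). cbn [pos] in Hdom.
  destruct (locally_norm_le_locally q _ Hdom) as [del K].
  exists (del / A)%R; split; [apply Rdiv_lt_0_compat; [apply cond_pos|lra]|].
  intros v Hv.
  assert (Ed : minus (plus p (scal (w + v) d)) q = scal v d).
  { assert (E : forall z a : C, z + (w + v) * a + - (z + w * a) = v * a) by (intros; ring).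
    unfold q; destruct p as [z [z1 z2]], d as [a [b c]].
    change ((z + (w + v) * a + - (z + w * a),
      (z1 + (w + v) * b + - (z1 + w * b), z2 + (w + v) * c + - (z2 + w * c)))
      = (v * a, (v * b, v * c)) :> C * (C * C)).
    now rewrite !E. }
  assert (Hn : (norm (scal v d) <= Cmod v * norm d)%R) by apply (norm_scal v d).
  specialize (K (plus p (scal (w + v) d))).
  assert (HK : ball_norm q del (plus p (scal (w + v) d))).
  { unfold ball_norm; rewrite Ed. eapply Rle_lt_trans; [exact Hn|].
    apply Rle_lt_trans with (A * Cmod v)%R.
    - generalize (Cmod_ge_0 v); unfold A; nra.
    - replace (pos del) with (A * (del / A))%R by (field; lra).
      now apply Rmult_lt_compat_l. }
  specialize (K HK). rewrite Ed in K.
  rewrite (linear_scal l Hl) in K.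
  change (Cmod (g (plus p (scal (w + v) d)) - g q - v * l d)%C <= eps / A * norm (scal v d))%R in K.
  rewrite (Cmult_comm v) in K.
  eapply Rle_trans; [exact K|].
  apply Rle_trans with (eps / A * (A * Cmod v))%R; [|right; field; lra].
  apply Rmult_le_compat_l; [lra|]. eapply Rle_trans; [exact Hn|].
  generalize (Cmod_ge_0 v); unfold A; nra.
Qed.

Lemma continuous_pair {T U V : UniformSpace} (f : T -> U) (g : T -> V) (x : T) :
  continuous f x -> continuous g x -> continuous (fun y => (f y, g y)) x.
Proof.
  intros Hf Hg; apply filterlim_locally; intros eps.
  apply filterlim_locally with (eps := eps) in Hf.
  apply filterlim_locally with (eps := eps) in Hg.
  generalize (filter_and _ _ Hf Hg).
  apply filter_imp; intros y [H3 H4]; split; assumption.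
Qed.

Section Lift.
Variables (tau : C) (g : C -> C -> C -> C).
Hypothesis Htau : (0 < Im tau)%R.
Hypothesis Hcont : Ccont (fun p : C * (C * C) => g (fst p) (fst (snd p)) (snd (snd p))).
Hypothesis Hline : forall z z1 z2 a b c,
  differentiable (fun w => g (z + w * a) (z1 + w * b) (z2 + w * c)).
Hypothesis Hact : forall (m n : Z) z z1 z2,
  g (z + (RtoC (IZR m) + RtoC (IZR n) * tau)) (z1 + RtoC (IZR n) * z2) z2 = g z z1 z2.

Lemma Ccont_lift {T : UniformSpace} (u v w : T -> C) :
  Ccont u -> Ccont v -> Ccont w -> Ccont (fun x => g (u x) (v x) (w x)).
Proof.
  intros Hu Hv Hw x.
  apply (continuous_comp (fun x => (u x, (v x, w x)))
    (fun p : C * (C * C) => g (fst p) (fst (snd p)) (snd (snd p)))); [|apply Hcont].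
  apply continuous_pair; [apply Hu|apply continuous_pair; [apply Hv|apply Hw]].
Qed.

Lemma lift_bounded (r0 r1 r2 : R) : exists M, (0 < M)%R /\ forall z z1 z2,
  (Cmod z <= r0)%R -> (Cmod z1 <= r1)%R -> (Cmod z2 <= r2)%R -> (Cmod (g z z1 z2) <= M)%R.
Proof.
  destruct (Ccont_bounded _ _ (gauge_compact_prod _ _ (gauge_compact_box r0)
    (gauge_compact_prod _ _ (gauge_compact_box r1) (gauge_compact_box r2))) Hcont)
    as [M [HM K]].
  exists M; split; [assumption|]. intros z z1 z2 H0 H1 H2.
  apply (K (z, (z1, z2))); cbn; auto using Cmod_box.
Qed.

(* The component of [g] that is homogeneous of degree [N] in [(z1, z2)]. *)
Definition homogeneous_part (N : nat) (z z1 z2 : C) : C :=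
  taylor_coef N (fun s => g z (s * z1) (s * z2)) 1.

Lemma differentiable_radial (z z1 z2 : C) :
  differentiable (fun s => g z (s * z1) (s * z2)).
Proof.
  generalize (Hline z 0 0 0 z1 z2); apply differentiable_ext; intros w.
  f_equal; ring.
Qed.

Lemma homogeneous_part_act (N : nat) (m n : Z) (z z1 z2 : C) :
  homogeneous_part N (z + (RtoC (IZR m) + RtoC (IZR n) * tau)) (z1 + RtoC (IZR n) * z2) z2 =
  homogeneous_part N z z1 z2.
Proof.
  apply avg_ext; intros t; f_equal. rewrite <- (Hact m n z). f_equal; ring.
Qed.

(** Positive real factors suffice for the growth bound; the identity is the dependence of a Taylor
    coefficient on the radius. *)
Lemma homogeneous_part_scale (N : nat) (z z1 z2 : C) (r : R) : (0 < r)%R ->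
  homogeneous_part N z z1 z2 =
  RtoC (r ^ N) * homogeneous_part N z (z1 / RtoC r) (z2 / RtoC r).
Proof.
  intros Hr. assert (Hr0 : RtoC r <> 0) by (apply RtoC_neq_0; lra).
  unfold homogeneous_part at 2.
  rewrite <- (taylor_coef_scale N (fun s => g z (s * (z1 / RtoC r)) (s * (z2 / RtoC r))) r)
    by apply differentiable_radial.
  apply avg_ext; intros t; do 2 f_equal; field; assumption.
Qed.

Lemma homogeneous_part_le (N : nat) (z z1 z2 : C) (M : R) :
  (forall t, (Cmod (g z (cis t * z1) (cis t * z2)) <= M)%R) ->
  (Cmod (homogeneous_part N z z1 z2) <= M)%R.
Proof.
  intros HM; apply avg_le.
  - apply Ccont_mult; [|apply Ccont_cisV]. apply Ccont_lift; auto 6 with ccont.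
  - intros t; rewrite Cmod_mult, Cmod_cisV, Rmult_1_r, Cmult_1_l; apply HM.
Qed.

Lemma homogeneous_part_growth (N : nat) (c : C) : exists A, (0 < A)%R /\ forall z z1,
  (Cmod (homogeneous_part N z z1 c) <= A * (1 + Cmod z + Cmod z1) ^ N)%R.
Proof.
  destruct (lift_bounded (1 + Im tau) 1 1) as [M [HM K]].
  (* Chosen so that r = B (1 + |z| + |z1|) dominates both |c| and |z1 - n c| <= |z1| + (|z| / Im tau
     + 1) |c|; dividing by [r] then lands in the unit polydisc where [M] is a bound. *)
  set (B := (1 + Cmod c + Cmod c / Im tau)%R).
  assert (Hc := Cmod_ge_0 c).
  assert (Hct : (0 <= Cmod c / Im tau)%R).
  { apply Rmult_le_pos; [assumption|]. now apply Rlt_le, Rinv_0_lt_compat. }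
  assert (HB : (0 < B)%R) by (unfold B; lra).
  exists (B ^ N * M)%R; split; [apply Rmult_lt_0_compat; [now apply pow_lt|assumption]|].
  intros z z1.
  (* These integers bring z into the fundamental rectangle with real part in [0, 1) and imaginary
     part in [0, Im tau). *)
  set (n := Int_part (Im z / Im tau)).
  set (m := Int_part (Re z - IZR n * Re tau)).
  assert (Hn := base_Int_part (Im z / Im tau)). fold n in Hn.
  assert (Hm := base_Int_part (Re z - IZR n * Re tau)). fold m in Hm.
  set (z0 := z - (RtoC (IZR m) + RtoC (IZR n) * tau)).
  assert (Ez : z = z0 + (RtoC (IZR m) + RtoC (IZR n) * tau)) by (unfold z0; ring).
  assert (HIm : (Im z = Im z / Im tau * Im tau)%R) by (field; lra).
  assert (Hz0 : (Cmod z0 <= 1 + Im tau)%R).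
  { eapply Rle_trans; [apply Cmod_le_sum|].
    replace (Re z0) with (Re z - IZR n * Re tau - IZR m)%R
      by (unfold z0, Re; cbn; ring).
    replace (Im z0) with (Im z - IZR n * Im tau)%R by (unfold z0, Im; cbn; ring).
    rewrite !Rabs_pos_eq; nra. }
  assert (Hz := Cmod_ge_0 z). assert (Hz1 := Cmod_ge_0 z1).
  assert (Hnz : (Rabs (IZR n) <= Cmod z / Im tau + 1)%R).
  { assert (Hq : (Rabs (Im z / Im tau) <= Cmod z / Im tau)%R).
    { unfold Rdiv; rewrite Rabs_mult, (Rabs_pos_eq (/ Im tau))
        by now apply Rlt_le, Rinv_0_lt_compat.
      apply Rmult_le_compat_r; [now apply Rlt_le, Rinv_0_lt_compat|apply Im_le_Cmod]. }
    revert Hq Hn; unfold Rabs; repeat destruct Rcase_abs; lra. }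
  set (r := (B * (1 + Cmod z + Cmod z1))%R).
  assert (Hr : (0 < r)%R) by (unfold r; apply Rmult_lt_0_compat; lra).
  assert (Hcr : (Cmod c <= r)%R).
  { unfold r. apply Rle_trans with (B * 1)%R; [unfold B; lra|].
    apply Rmult_le_compat_l; lra. }
  assert (Hur : (Cmod (z1 - RtoC (IZR n) * c) <= r)%R).
  { unfold Cminus; eapply Rle_trans; [apply Cmod_triangle|].
    rewrite Cmod_opp, Cmod_mult, Cmod_R.
    apply Rle_trans with (Cmod z1 + (Cmod z / Im tau + 1) * Cmod c)%R.
    { apply Rplus_le_compat_l, Rmult_le_compat_r; assumption. }
    replace ((Cmod z / Im tau + 1) * Cmod c)%R
      with (Cmod z * (Cmod c / Im tau) + Cmod c)%R by (field; lra).
    unfold r, B. set (e := (Cmod c / Im tau)%R) in *.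
    assert (0 <= Cmod z * Cmod c)%R by now apply Rmult_le_pos.
    assert (0 <= Cmod z1 * Cmod c)%R by now apply Rmult_le_pos.
    assert (0 <= Cmod z1 * e)%R by now apply Rmult_le_pos.
    nra. }
  rewrite Ez at 1.
  replace z1 with ((z1 - RtoC (IZR n) * c) + RtoC (IZR n) * c) at 1 by ring.
  rewrite homogeneous_part_act.
  rewrite (homogeneous_part_scale N z0 _ _ r Hr).
  rewrite Cmod_mult, Cmod_R, Rabs_pos_eq by now apply Rlt_le, pow_lt.
  replace (B ^ N * M * (1 + Cmod z + Cmod z1) ^ N)%R with (r ^ N * M)%R
    by (unfold r; rewrite Rpow_mult_distr; ring).
  apply Rmult_le_compat_l; [now apply Rlt_le, pow_lt|].
  assert (Hr0 : RtoC r <> 0) by (apply RtoC_neq_0; lra).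
  assert (D : forall u, (Cmod u <= r)%R -> forall t, (Cmod (cis t * (u / RtoC r)) <= 1)%R).
  { intros u Hu t. rewrite Cmod_mult, Cmod_cis, Rmult_1_l, Cmod_div by assumption.
    rewrite Cmod_R, Rabs_pos_eq by lra.
    apply Rmult_le_reg_r with r; [assumption|].
    unfold Rdiv; rewrite Rmult_assoc, Rinv_l by lra. lra. }
  apply homogeneous_part_le; intros t; apply K; auto.
Qed.

Lemma homogeneous_part_const (N : nat) (z z1 c : C) : c <> 0 ->
  homogeneous_part N z z1 c = homogeneous_part N 0 0 c.
Proof.
  intros Hc. destruct (homogeneous_part_growth N c) as [A [HA K]].
  assert (Hz : forall z1 z, homogeneous_part N z z1 c = homogeneous_part N 0 z1 c).
  { clear z z1; intros z1.
    apply (periodic_polynomial_growth_constant N (fun z => homogeneous_part N z z1 c) 1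
      (A * (1 + Cmod z1) ^ N)).
    - apply differentiable_avg.
      + intros t. apply (differentiable_scal (fun w => g w _ _)).
        generalize (Hline 0 (RtoC 1 * cis t * z1) (RtoC 1 * cis t * c) 1 0 0).
        apply differentiable_ext; intros w; f_equal; ring.
      + intros w. apply Ccont_mult; [apply Ccont_lift; auto 6 with ccont|apply Ccont_cisV].
      + intros rho. destruct (lift_bounded rho (Cmod z1) (Cmod c)) as [M [_ HM]].
        exists M; intros w t Hw.
        rewrite Cmod_mult, Cmod_cisV, Rmult_1_r. apply HM; [assumption|..];
        rewrite Cmult_1_l, Cmod_mult, Cmod_cis; lra.
    (* For fixed z1 the growth in z alone follows from 1 + |z| + |z1| <= (1 + |z1|) (1 + |z|). *)
    - intros z. rewrite Rmult_assoc, <- Rpow_mult_distr.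
      eapply Rle_trans; [apply K|]. apply Rmult_le_compat_l; [lra|].
      generalize (Cmod_ge_0 z) (Cmod_ge_0 z1); intros. apply pow_incr; nra.
    - intros E; apply RtoC_inj in E; lra.
    - intros z. rewrite <- (homogeneous_part_act N 1 0 z). f_equal; ring. }
  rewrite Hz. revert z1.
  apply (periodic_polynomial_growth_constant N (fun w => homogeneous_part N 0 w c) c A).
  - apply differentiable_avg.
    + intros t. apply (differentiable_scal (fun w => g _ (_ * w) _)).
      generalize (Hline 0 0 (RtoC 1 * cis t * c) 0 (RtoC 1 * cis t) 0).
      apply differentiable_ext; intros w; f_equal; ring.
    + intros w. apply Ccont_mult; [apply Ccont_lift; auto 6 with ccont|apply Ccont_cisV].
    + intros rho. destruct (lift_bounded 0 rho (Cmod c)) as [M [_ HM]].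
      exists M; intros w t Hw.
      rewrite Cmod_mult, Cmod_cisV, Rmult_1_r. apply HM;
      rewrite ?Cmod_0, ?Cmult_1_l, ?Cmod_mult, ?Cmod_cis; lra.
  - intros w. specialize (K 0 w). now rewrite Cmod_0, Rplus_0_r in K.
  - assumption.
  - intros w.
    (* The second generator moves z by tau along with z1, so it becomes a period in z1 only because
       independence of z is already known. *)
    transitivity (homogeneous_part N (0 + (RtoC (IZR 0) + RtoC (IZR 1) * tau))
      (w + RtoC (IZR 1) * c) c); [symmetry; rewrite Hz; f_equal; ring|].
    apply homogeneous_part_act.
Qed.

Lemma lift_eq_at_origin (z z1 z2 : C) : g z z1 z2 = g 0 0 z2.
Proof.
  assert (Hne : forall c : C, c <> 0 -> g z z1 c = g 0 0 c).
  { intros c Hc.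
    (* The point of interest would be s = 1, on the boundary of the disk where vanishing
       coefficients force vanishing; doubling the direction moves it to s = 1/2. *)
    set (h s := g z (s * (2 * z1)) (s * (2 * c)) - g 0 (s * 0) (s * (2 * c))).
    assert (H2 : RtoC 2 <> 0) by (apply RtoC_neq_0; lra).
    assert (H : h (1 / 2) = 0).
    { apply taylor_coef_vanish.
      - apply differentiable_minus; apply differentiable_radial.
      - intros N. unfold taylor_coef.
        rewrite (avg_ext _ (fun t =>
          g z (RtoC 1 * cis t * (2 * z1)) (RtoC 1 * cis t * (2 * c)) * cisV N t -
          g 0 (RtoC 1 * cis t * 0) (RtoC 1 * cis t * (2 * c)) * cisV N t))
          by (intros; unfold h; ring).
        rewrite avg_minus by
          (apply Ccont_mult; [apply Ccont_lift; auto 6 with ccont|apply Ccont_cisV]).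
        assert (E := homogeneous_part_const N z (2 * z1) (2 * c) (Cmult_neq_0 _ _ H2 Hc)).
        unfold homogeneous_part, taylor_coef in E. rewrite E. ring.
      - replace (1 / 2) with (RtoC (1 / 2)) by (rewrite RtoC_div; [reflexivity|lra]).
        rewrite Cmod_R, Rabs_pos_eq; lra. }
    assert (E : forall u, 1 / 2 * (2 * u) = u) by (intros; field; assumption).
    unfold h in H. rewrite !E, Cmult_0_r in H.
    replace (g z z1 c) with (g z z1 c - g 0 0 c + g 0 0 c) by ring. rewrite H; ring. }
  destruct (classic (z2 = 0)) as [->|H2]; [|auto].
  set (k c := g z z1 c - g 0 0 c).
  assert (Hk : Ccont k) by (apply Ccont_minus; apply Ccont_lift; auto with ccont).
  assert (E : Cmod (k 0) = 0%R).
  { apply Rle_antisym; [|apply Cmod_ge_0]. apply le_epsilon; intros eps He.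
    destruct (Ccont_uniformly k 0 eps Hk He) as [d [Hd K]].
    specialize (K 0 (RtoC (d / 2))).
    assert (Hc : Cmod (RtoC (d / 2)) = (d / 2)%R) by (apply Cmod_RtoC_nonneg; lra).
    replace (RtoC (d / 2) - 0) with (RtoC (d / 2)) in K by ring.
    rewrite Cmod_0, Hc in K. specialize (K ltac:(lra) ltac:(lra)).
    replace (k (RtoC (d / 2)) - k 0) with (- k 0) in K.
    - rewrite Cmod_opp in K; lra.
    - unfold k at 2. rewrite Hne; [ring|]. intros E; apply RtoC_inj in E; lra. }
  apply Cmod_eq_0 in E. unfold k in E.
  replace (g z z1 0) with (g z z1 0 - g 0 0 0 + g 0 0 0) by ring. rewrite E; ring.
Qed.

End Lift.

Theorem proposition1p2 (tau : C) (Htau : (0 < Im tau)%R)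
    (f : X tau -> C) (Hf : holomorphic tau f) :
  exists F : C -> C, entire F /\
    forall z z1 z2 : C, f (quot tau (z, (z1, z2))) = F z2.
Proof.
  set (G := (fun p => f (quot tau p)) : C3 -> C).
  assert (HG : forall q, ex_filterdiff (V := C_NormedModule) G (locally q)).
  { intros q. destruct (chart_domain_cover tau Htau q) as [U [HU Hq]]. exact (Hf U HU q Hq). }
  assert (Hline : forall z z1 z2 a b c : C,
    differentiable (fun w => G (z + w * a, (z1 + w * b, z2 + w * c)))).
  { intros. exact (filterdiff_differentiable_line G (z, (z1, z2)) (a, (b, c)) HG). }
  exists (fun z2 : C => G (RtoC 0, (RtoC 0, z2))); split.
  - apply differentiable_entire. generalize (Hline 0 0 0 0 0 1).
    apply differentiable_ext; intros w. do 2 f_equal; [ring|f_equal; ring].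
  - apply (lift_eq_at_origin tau (fun z z1 z2 : C => G (z, (z1, z2))) Htau).
    + intros [z [z1 z2]]. apply (continuous_ext G); [now intros [? [? ?]]|].
      exact (filterdiff_continuous G _ (HG _)).
    + exact Hline.
    + intros m n z z1 z2. unfold G; f_equal; symmetry; apply quot_eq.
      now exists m, n.
Qed.
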